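(* Let $\Delta$ be a reduced irreducible finite root system, let $G$ be a free abelian group, and let $R\subseteq G\times\Delta$ be a tame root system of the kind $\Delta$ extended by $G$. Let $T$ be the symmetric system associated to $R$, let $\mathcal U$ be the initial $T$-reflection group and $\mathcal W$ the Weyl group of $R$. If $\Delta$ is of type $A_\ell$ ($\ell\ge2$), $D_\ell$ ($\ell\ge4$), $E_\ell$ ($6\le\ell\le8$), $F_4$ or $G_2$, then the $T$-reflection morphism $\mathcal U\to\mathcal W$ is an isomorphism.
   Context: **Symmetric systems and reflection groups.** A symmetric system is a set $T$ with a multiplication $(s,t)\mapsto s.t$ such that $s.(s.t)=t$ and $r.(s.t)=(r.s).(r.t)$ for all $r,s,t\in T$. A $T$-reflection group is a group $\mathcal X$ acting on $T$ (action written $x.t$) together with a map $T\to\mathcal X$, $t\mapsto t^{\mathcal X}$, such that: (G1) $\mathcal X$ is generated by $\{t^{\mathcal X}\mid t\in T\}$; (G2) $t^{\mathcal X}.s=t.s$; (G3) $t^{\mathcal X}s^{\mathcal X}(t^{\mathcal X})^{-1}=(t.s)^{\mathcal X}$; (G4) $(t^{\mathcal X})^2=1$, for all $s,t\in T$. A $T$-reflection morphism $\mathcal X\to\mathcal Y$ is a group homomorphism sending $t^{\mathcal X}$ to $t^{\mathcal Y}$ for all $t\in T$. The initial $T$-reflection group $\mathcal U$ is the one having a unique $T$-reflection morphism to every $T$-reflection group; it is the group presented by generators $t^{\mathcal U}$ ($t\in T$) and relations $(t^{\mathcal U})^2=1$, $t^{\mathcal U}s^{\mathcal U}(t^{\mathcal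 U})^{-1}=(t.s)^{\mathcal U}$ ($s,t\in T$). **Finite root system.** $\Delta$ is a reduced irreducible finite (crystallographic) root system, $\alpha\mapsto\alpha^\vee$ is the bijection to the coroots, $\mathcal L$ is the root lattice, $\mathcal L^\vee$ the coroot lattice, $\langle\cdot,\cdot\rangle:\mathcal L^\vee\times\mathcal L\to\mathbb Z$ the pairing, $r_\alpha$ the reflection acting by $r_\alpha.\lambda=\lambda-\langle\alpha^\vee,\lambda\rangle\alpha$ on $\mathcal L$ and $r_\alpha.\mu=\mu-\langle\mu,\alpha\rangle\alpha^\vee$ on $\mathcal L^\vee$, and $\mathcal V$ the Weyl group of $\Delta$, generated by the $r_\alpha$. $\Delta_{\mathrm{sh}}$ and $\Delta_{\mathrm{lg}}$ are the sets of short and long roots; if there is only one root length (simply laced type) all roots are called short. **Extended root systems.** $G$ is a torsion-free abelian group. For $(g,\alpha)\in G\times\Delta$ let $r_{(g,\alpha)}\in\mathrm{Aut}(G\times\mathcal L)$, $r_{(g,\alpha)}(h,\beta)=(h-\langle\alpha^\vee,\beta\rangle g,\ r_\alpha.\beta)$. A subset $R\subseteq G\times\Delta$ is a root system of the kind $\Delta$ extended by $G$ if: (R0) the projection $R\to\Delta$ is surjective; (R1) the image of the projection $R\to G$ generates $G$; (R2) $\{0\}\times\Delta\subseteq R$; (R3) $r_a(R)\subseteq R$ for every $a\in R$. Put $S_\alpha=\{g\in G\mid(g,\alpha)\in R\}$; it depends only on the length of $\alpha$, and $S_{\mathrm{sh}}$, $S_{\mathrm{lg}}$ denote $S_\alpha$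 for $\alpha$ short, resp. long. Put $k_\Delta=2$ for types $B_\ell(\ell\ge2),C_\ell(\ell\ge3),F_4$ and $k_\Delta=3$ for type $G_2$. For $\Delta$ non-simply laced, a decomposition $G=G_1\oplus G_2$ is a twist decomposition if $S_{\mathrm{sh}}=(S_{\mathrm{sh}}\cap G_1)+\langle S_{\mathrm{lg}}\cap G_2\rangle$ and $S_{\mathrm{lg}}=k_\Delta\langle S_{\mathrm{sh}}\cap G_1\rangle+(S_{\mathrm{lg}}\cap G_2)$. $R$ is tame if it is of simply laced type, or if it is of non-simply laced type and $G$ has a twist decomposition. **Symmetric system, $\mathcal A$ and $\mathcal K$.** $T=\{r_a\mid a\in R\}\subseteq\mathrm{Aut}(G\times\mathcal L)$ with multiplication $s.t=sts^{-1}$ is the symmetric system associated to $R$. For $t=r_{(g,\alpha)}$ put $\overline t=r_\alpha\in\mathcal V$. $\mathcal A$ is the subgroup generated by $T$, acting on $T$ by conjugation; with $t^{\mathcal A}=t$ it is a $T$-reflection group. $G\otimes\mathcal L^\vee$ is identified with a subgroup of $\mathrm{Hom}(\mathcal L,G)$ via $(g\otimes\mu)(\lambda)=\langle\mu,\lambda\rangle g$; $(\phi,\psi)\in\mathrm{Hom}(\mathcal L,G)\rtimes\mathrm{Aut}(\mathcal L)$ acts on $G\times\mathcal L$ by $(h,\lambda)\mapsto(h+\phi(\psi(\lambda)),\psi(\lambda))$, so $r_{(g,\alpha)}=(g\otimes\alpha^\vee,r_\alpha)$. $\mathcal K$ is the subgroup of $G\otimes\mathcal L^\vee$ generated by all $g\otimes\alpha^\vee$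 with $(g,\alpha)\in R$; $\mathcal V$ acts on it via $v.(g\otimes\mu)=g\otimes v.\mu$, and $\mathcal A=\mathcal K\rtimes\mathcal V$. For $t=r_{(g,\alpha)}$ put $t^{\mathcal K}=g\otimes\alpha^\vee$. **Weyl group.** Let $\mathcal Z$ be an abelian group and $b:\mathcal K\times\mathcal K\to\mathcal Z$ a bihomomorphism that is alternating and $\mathcal V$-invariant ($b(v.k,v.k')=b(k,k')$). Let $\mathcal K^b=\mathcal Z\times\mathcal K$ with product $(z_1,k_1)(z_2,k_2)=(z_1+z_2+b(k_1,k_2),k_1+k_2)$ and $\mathcal V$-action $v.(z,k)=(z,v.k)$. Let $\mathcal A^b$ be the subgroup of $\mathcal K^b\rtimes\mathcal V$ generated by the elements $t^{\mathcal A^b}=(0,t^{\mathcal K},\overline t)$, $t\in T$, acting on $T$ through the projection $(z,k,v)\mapsto(k,v)$ to $\mathcal A$. Then $b$ is a reflection bihomomorphism if $\mathcal A^b$ is a $T$-reflection group; it is admissible if moreover $b(s^{\mathcal K},t^{\mathcal K})=0$ for all $s,t\in T$ such that $\overline s\ne\overline t$ and $\overline s,\overline t$ commute. There is a universal admissible reflection bihomomorphism $\curlywedge:\mathcal K\times\mathcal K\to\mathcal K\curlywedge\mathcal K$, i.e. every admissible $b:\mathcal K\times\mathcal K\to B$ equals $\phi\circ\curlywedge$ for a unique homomorphism $\phi:\mathcal K\curlywedge\mathcal K\to B$. For tame $R$, the Weyl group of $R$ is the $T$-reflection group $\mathcal W=\mathcal A^{\curlywedge}$. *)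

(* Defs.v *)
From HB Require Import structures.
From mathcomp Require Import all_boot all_order all_algebra.
From mathcomp Require Import finmap boolp classical_sets functions reals.
From mathcomp Require Import ring.
Set Implicit Arguments.
Unset Strict Implicit.
Unset Printing Implicit Defensive.
Import Order.TTheory GRing.Theory Num.Theory.
Local Open Scope ring_scope.
Local Open Scope classical_set_scope.

Definition is_zsubgroup (M : zmodType) (A : set M) : Prop :=
  A 0 /\ (forall x y, A x -> A y -> A (x - y)).

Definition zspan (M : zmodType) (A : set M) : set M := smallest (@is_zsubgroup M) A.

Lemma zspan_sub (M : zmodType) (A : set M) : is_zsubgroup (zspan A).
Proof.
split=> [B [[B0 _] _] //|x y Ax Ay B [] /[dup] -[_ BB] sB AB].
by apply: BB; [apply: Ax|apply: Ay].
Qed.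

Lemma zspan_gen (M : zmodType) (A : set M) x : A x -> zspan A x.
Proof. by move=> Ax B [_]; apply. Qed.

Lemma zspan_ind (M : zmodType) (A : set M) (P : set M) :
    (forall x, A x -> P x) -> P 0 -> (forall x y, P x -> P y -> P (x - y)) ->
  forall x, zspan A x -> P x.
Proof. by move=> AP P0 PB x; apply; split. Qed.

Definition zgen (M : zmodType) (A : set M) : Type := {x : M | x \in zspan A}.

Section ZgenInstances.
Variables (M : zmodType) (A : set M).
Fact zgen_closed : zmod_closed (fun x : M => x \in zspan A).
Proof.
have [A0 AB] := zspan_sub A; split=> [|x y]; rewrite !inE; last exact: AB.
exact: A0.
Qed.
HB.instance Definition _ := SubChoice.on (zgen A).
HB.instance Definition _ :=
  GRing.SubChoice_isSubZmodule.Build M (fun x : M => x \in zspan A) (zgen A)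
    zgen_closed.
End ZgenInstances.

Definition is_gsubgroup (X : groupType) (A : set X) : Prop :=
  [/\ A 1%g, (forall x y, A x -> A y -> A (x * y)%g)
     & (forall x, A x -> A x^-1%g)].

Definition gspan (X : groupType) (A : set X) : set X := smallest (@is_gsubgroup X) A.

Lemma gspan_sub (X : groupType) (A : set X) : is_gsubgroup (gspan A).
Proof.
split=> [B [[B0 _ _] _] //|x y Ax Ay B|x Ax B] [] /[dup] -[_ BM BV] sB AB.
  by apply: BM; [apply: Ax|apply: Ay].
by apply: BV; apply: Ax.
Qed.

Lemma gspan_gen (X : groupType) (A : set X) x : A x -> gspan A x.
Proof. by move=> Ax B [_]; apply. Qed.

Lemma gspan_ind (X : groupType) (A : set X) (P : set X) :
    (forall x, A x -> P x) -> P 1%g -> (forall x y, P x -> P y -> P (x * y)%g) ->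
    (forall x, P x -> P x^-1%g) ->
  forall x, gspan A x -> P x.
Proof. by move=> AP P1 PM PV x; apply; split. Qed.

Definition ggen (X : groupType) (A : set X) : Type := {x : X | x \in gspan A}.

Section GgenInstances.
Variables (X : groupType) (A : set X).
Fact ggen_closed : group_closed (fun x : X => x \in gspan A).
Proof.
have [A1 AM AV] := gspan_sub A; split=> [|x y]; rewrite !inE.
  exact: A1.
by move=> Ax Ay; apply: AM => //; apply: AV.
Qed.
HB.instance Definition _ := SubChoice.on (ggen A).
HB.instance Definition _ :=
  SubChoice_isSubGroup.Build X (fun x : X => x \in gspan A) (ggen A) ggen_closed.
End GgenInstances.

Record aut (M : zmodType) := Aut {
  aut_fun :> M -> M;
  aut_inv : M -> M;
  aut_funK : cancel aut_fun aut_inv;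
  aut_invK : cancel aut_inv aut_fun;
  aut_add : {morph aut_fun : x y / x + y}
}.

Lemma autP (M : zmodType) (f g : aut M) : f =1 g -> f = g.
Proof.
case: f g => [f f' fK f'K fD] [g g' gK g'K gD] /= /funext fg.
move: fK f'K fD; rewrite {f}fg => fK f'K fD.
have fg' : f' = g' by apply/funext => x; rewrite -{1}[x]g'K fK.
move: fK f'K; rewrite {f'}fg' => fK f'K.
by congr Aut; apply: Prop_irrelevance.
Qed.

Section AutGroup.
Variable M : zmodType.
Implicit Types f g : aut M.
HB.instance Definition _ := gen_eqMixin (aut M).
HB.instance Definition _ := gen_choiceMixin (aut M).

Definition aut1 : aut M := @Aut M id id (fun=> erefl) (fun=> erefl) (fun _ _ => erefl).
Definition autM f g : aut M.
Proof.
refine (@Aut M (f \o g) (aut_inv g \o aut_inv f) _ _ _).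
- exact: (can_comp (aut_funK f) (aut_funK g)).
- exact: (can_comp (aut_invK g) (aut_invK f)).
- by move=> x y /=; rewrite !aut_add.
Defined.
Definition autV f : aut M.
Proof.
refine (@Aut M (aut_inv f) f (aut_invK f) (aut_funK f) _).
by move=> x y; rewrite -{1}[x](aut_invK f) -{1}[y](aut_invK f) -aut_add aut_funK.
Defined.
Fact autMA : associative autM. Proof. by move=> f g h; apply: autP. Qed.
Fact aut1M : left_id aut1 autM. Proof. by move=> f; apply: autP. Qed.
Fact autM1 : right_id aut1 autM. Proof. by move=> f; apply: autP. Qed.
Fact autVM : left_inverse aut1 autV autM.
Proof. by move=> f; apply: autP => x /=; rewrite aut_funK. Qed.
Fact autMV : right_inverse aut1 autV autM.
Proof. by move=> f; apply: autP => x /=; rewrite aut_invK. Qed.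
HB.instance Definition _ := isGroup.Build (aut M) autMA aut1M autM1 autVM autMV.

Fact aut_is_zmod_morphism f : zmod_morphism f.
Proof. by move=> x y; rewrite -{2}[x](subrK y) (aut_add f (x - y)) addrK. Qed.
HB.instance Definition _ f := GRing.isZmodMorphism.Build M M f (aut_is_zmod_morphism f).

Lemma autME f g x : (f * g)%g x = f (g x). Proof. by []. Qed.
Lemma aut1E x : (1%g : aut M) x = x. Proof. by []. Qed.
Lemma autVE f : (f^-1)%g = aut_inv f :> (M -> M). Proof. by []. Qed.
End AutGroup.

Record gaction (H N : groupType) := GAction {
  gact :> H -> N -> N;
  gact1 : forall x, gact 1%g x = x;
  gactM : forall g h x, gact (g * h)%g x = gact g (gact h x);
  gactMr : forall g x y, gact g (x * y)%g = (gact g x * gact g y)%g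
}.

Definition sdprod (H N : groupType) (a : gaction H N) : Type := (N * H)%type.

Section Sdprod.
Variables (H N : groupType) (a : gaction H N).
Implicit Types p q : sdprod a.
HB.instance Definition _ := Choice.on (sdprod a).
Definition sd_one : sdprod a := (1%g, 1%g).
Definition sd_mul p q : sdprod a := ((p.1 * a p.2 q.1)%g, (p.2 * q.2)%g).
Definition sd_inv p : sdprod a := (a p.2^-1%g p.1^-1%g, p.2^-1%g).
Fact gact_one g : a g 1%g = 1%g.
Proof. by apply: (mulgI (a g 1%g)); rewrite -gactMr !mulg1. Qed.
Fact sd_mulA : associative sd_mul.
Proof. by move=> p q r; rewrite /sd_mul /= gactM gactMr !mulgA. Qed.
Fact sd_mul1 : left_id sd_one sd_mul.
Proof. by case=> x g; rewrite /sd_mul /= gact1 !mul1g. Qed.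
Fact sd_mulr1 : right_id sd_one sd_mul.
Proof. by case=> x g; rewrite /sd_mul /= gact_one !mulg1. Qed.
Fact sd_mulV : left_inverse sd_one sd_inv sd_mul.
Proof. by case=> x g; rewrite /sd_mul /= -gactMr !mulVg gact_one. Qed.
Fact sd_mulrV : right_inverse sd_one sd_inv sd_mul.
Proof. by case=> x g; rewrite /sd_mul /= -gactM !mulgV gact1 mulgV. Qed.
HB.instance Definition _ :=
  isGroup.Build (sdprod a) sd_mulA sd_mul1 sd_mulr1 sd_mulV sd_mulrV.
End Sdprod.

Record symSystem := SymSystem {
  sym_sort :> Type;
  sym_op : sym_sort -> sym_sort -> sym_sort;
  sym_opK : forall s t, sym_op s (sym_op s t) = t;
  sym_opD : forall r s t, sym_op r (sym_op s t) = sym_op (sym_op r s) (sym_op r t)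
}.

Record is_reflection_group (T : symSystem) (X : groupType)
    (act : X -> T -> T) (gen : T -> X) : Prop := {
  rg_act1 : forall t, act 1%g t = t;
  rg_actM : forall x y t, act (x * y)%g t = act x (act y t);
  rg_G1 : gspan (range gen) = setT;
  rg_G2 : forall t s, act (gen t) s = sym_op t s;
  rg_G3 : forall t s, (gen t * gen s * (gen t)^-1)%g = gen (sym_op t s);
  rg_G4 : forall t, (gen t * gen t)%g = 1%g
}.

Record reflGroup (T : symSystem) := ReflGroup {
  rg_group :> groupType;
  rg_act : rg_group -> T -> T;
  rg_gen : T -> rg_group;
  rg_prop : is_reflection_group rg_act rg_gen
}.

Definition is_refl_morphism (T : symSystem) (X Y : reflGroup T) (f : X -> Y) : Prop :=
  {morph f : x y / (x * y)%g} /\ forall t, f (rg_gen X t) = rg_gen Y t.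

Definition is_initial (T : symSystem) (U : reflGroup T) : Prop :=
  forall Y : reflGroup T, exists! f : U -> Y, is_refl_morphism f.

Section Euclidean.
Variables (R : realType) (n : nat).
Implicit Types u v a : 'rV[R]_n.
Definition dot u v : R := \sum_(i < n) u 0 i * v 0 i.
Definition coroot a : 'rV[R]_n := (2 / dot a a) *: a.
Definition reflection a v : 'rV[R]_n := v - dot (coroot a) v *: a.

Lemma dotC u v : dot u v = dot v u.
Proof. by apply: eq_bigr => i _; rewrite mulrC. Qed.
Lemma dotDr u v w : dot u (v + w) = dot u v + dot u w.
Proof. by rewrite -big_split; apply: eq_bigr => i _; rewrite mxE mulrDr. Qed.
Lemma dotZr c u v : dot u (c *: v) = c * dot u v.
Proof. by rewrite mulr_sumr; apply: eq_bigr => i _; rewrite mxE mulrCA. Qed.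
Lemma dotNr u v : dot u (- v) = - dot u v.
Proof. by rewrite -scaleN1r dotZr mulN1r. Qed.
Lemma dotBr u v w : dot u (v - w) = dot u v - dot u w.
Proof. by rewrite dotDr dotNr. Qed.
Lemma dot0r u : dot u 0 = 0.
Proof. by rewrite -(scale0r (0 : 'rV[R]_n)) dotZr mul0r. Qed.
Lemma dotDl u v w : dot (v + w) u = dot v u + dot w u.
Proof. by rewrite dotC dotDr !(dotC u). Qed.
Lemma dotZl c u v : dot (c *: v) u = c * dot v u.
Proof. by rewrite dotC dotZr (dotC u). Qed.
Lemma dotBl u v w : dot (v - w) u = dot v u - dot w u.
Proof. by rewrite dotC dotBr !(dotC u). Qed.
Lemma dot_eq0 u : (dot u u == 0) = (u == 0).
Proof.
apply/idP/eqP => [|->]; last by rewrite dot0r.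
rewrite psumr_eq0 => [/allP u0|i _]; last by rewrite -expr2 sqr_ge0.
apply/rowP => i; rewrite mxE; apply/eqP.
by have := u0 i (mem_index_enum i); rewrite /= mulf_eq0 orbb.
Qed.
End Euclidean.

Record rootSystem (R : realType) (n : nat) := RootSystem {
  roots : {fset 'rV[R]_n};
  root_span : <<enum_fset roots>>%VS = fullv;
  root_neq0 : 0 \notin roots;
  root_refl : forall a b, a \in roots -> b \in roots -> reflection a b \in roots;
  root_int : forall a b, a \in roots -> b \in roots ->
    dot (coroot a) b \is a Num.int;
  root_reduced : forall a (c : R), a \in roots -> c *: a \in roots ->
    c = 1 \/ c = -1;
  root_nonempty : exists a, a \in roots;
  root_irreducible : forall A B : {fset 'rV[R]_n}, roots = (A `|` B)%fset ->
    (forall a b, a \in A -> b \in B -> dot a b = 0) -> A = fset0 \/ B = fset0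
}.

Section RootSystem.
Variables (R : realType) (n : nat) (D : rootSystem R n).
Local Notation E := 'rV[R]_n.

Definition root : Type := roots D.
HB.instance Definition _ := Finite.on root.
Definition root_val (a : root) : E := val a.
Local Coercion root_val : root >-> matrix.
Lemma root_mem (a : root) : root_val a \in roots D. Proof. exact: fsvalP. Qed.

Definition root_lattice : Type := zgen [set v : E | v \in roots D].
HB.instance Definition _ := GRing.Zmodule.on root_lattice.
Definition lat_val (l : root_lattice) : E := val l.

Fact root_lattice_subproof (a : root) : root_val a \in zspan [set v : E | v \in roots D].
Proof. by rewrite inE; apply: zspan_gen; apply: root_mem. Qed.
Definition root_lat (a : root) : root_lattice :=
  exist (fun x => x \in zspan _) (root_val a) (root_lattice_subproof a).

(* The pairing of a coroot with an element of the root lattice, as an integer: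
   the scalar product is an integer by [pairingE], so [Num.floor] is a mere cast. *)
Definition pairing (a : root) (l : root_lattice) : int :=
  Num.floor (dot (coroot a) (lat_val l)).

Lemma root_normN0 (a : root) : dot a a != 0.
Proof.
rewrite dot_eq0; apply: contraTneq (root_mem a) => ->.
exact: root_neq0.
Qed.

Lemma pairingE a l : (pairing a l)%:~R = dot (coroot a) (lat_val l).
Proof.
apply: floorK; have := set_mem (valP l); rewrite -/(lat_val l).
apply: (@zspan_ind _ _ [set v | dot (coroot a) v \is a Num.int])
  => [b Db||x y xP yP] /=.
- exact: root_int (root_mem a) Db.
- by rewrite dot0r rpred0.
- by rewrite dotBr rpredB.
Qed.

Lemma intr_injR (x y : int) : x%:~R = y%:~R :> R -> x = y.
Proof. exact: intr_inj. Qed.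

Lemma lat_val_inj : injective lat_val. Proof. exact: val_inj. Qed.
Lemma lat_valB x y : lat_val (x - y) = lat_val x - lat_val y. Proof. by []. Qed.
Lemma lat_valD x y : lat_val (x + y) = lat_val x + lat_val y. Proof. by []. Qed.
Lemma lat_valMz x (m : int) : lat_val (x *~ m) = m%:~R *: lat_val x.
Proof. by rewrite scaler_int /lat_val raddfMz. Qed.

Lemma pairingD a x y : pairing a (x + y) = pairing a x + pairing a y.
Proof. by apply: intr_injR; rewrite rmorphD /= !pairingE lat_valD dotDr. Qed.
Lemma pairingB a x y : pairing a (x - y) = pairing a x - pairing a y.
Proof. by apply: intr_injR; rewrite rmorphB /= !pairingE lat_valB dotBr. Qed.
Lemma pairingMz a x (m : int) : pairing a (x *~ m) = pairing a x * m.
Proof.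
by apply: intr_injR; rewrite rmorphM /= !pairingE lat_valMz dotZr mulrC.
Qed.
Lemma pairing_root a : pairing a (root_lat a) = 2.
Proof.
apply: intr_injR; rewrite pairingE /lat_val /= dotZl divfK //.
exact: root_normN0.
Qed.

Lemma pairing_refl_self a l : pairing a (l - root_lat a *~ pairing a l) = - pairing a l.
Proof. by rewrite pairingB pairingMz pairing_root; ring. Qed.

Definition refl_root (a b : root) : root :=
  [` root_refl (root_mem a) (root_mem b)]%fset.

Definition refl_lat_fun (a : root) (l : root_lattice) : root_lattice :=
  l - root_lat a *~ pairing a l.
Fact refl_latK a : involutive (refl_lat_fun a).
Proof.
by move=> l; rewrite /refl_lat_fun pairing_refl_self mulrNz opprK subrK.
Qed.
Fact refl_latD a : {morph refl_lat_fun a : x y / x + y}.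
Proof. by move=> x y; rewrite /refl_lat_fun pairingD mulrzDr opprD addrACA. Qed.
Definition refl_lat (a : root) : aut root_lattice :=
  Aut (refl_latK a) (refl_latK a) (refl_latD a).

Lemma refl_lat_val a l : lat_val (refl_lat a l) = reflection a (lat_val l).
Proof. by rewrite /= /refl_lat_fun lat_valB lat_valMz pairingE. Qed.

Lemma root_lat_refl a b : root_lat (refl_root a b) = refl_lat a (root_lat b).
Proof. by apply: lat_val_inj; rewrite refl_lat_val. Qed.

Lemma dot_reflection (a : root) (u v : E) :
  dot (reflection a u) (reflection a v) = dot u v.
Proof.
have := root_normN0 a; rewrite /reflection /coroot; set N := dot a a => N0.
rewrite !(dotBl, dotBr, dotZl, dotZr) (dotC u a) -/N.
by set x := dot a u; set y := dot a v; field.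
Qed.

Lemma pairing_refl a b l : pairing (refl_root a b) (refl_lat a l) = pairing b l.
Proof.
apply: intr_injR; rewrite !pairingE refl_lat_val /coroot !dotZl.
by rewrite /root_val /= !dot_reflection.
Qed.

Lemma pairing_refl_r a b l : pairing b (refl_lat a l) = pairing (refl_root a b) l.
Proof. by rewrite -(refl_latK a l) pairing_refl refl_latK. Qed.

Lemma refl_lat_conj a b l :
  refl_lat a (refl_lat b (refl_lat a l)) = refl_lat (refl_root a b) l.
Proof.
have reflbE c k : refl_lat c k = k - root_lat c *~ pairing c k by [].
have reflB x y : refl_lat a (x - y) = refl_lat a x - refl_lat a y by exact: raddfB.
have reflMz x m : refl_lat a (x *~ m) = refl_lat a x *~ m by exact: raddfMz.
by rewrite (reflbE b) reflB reflMz -root_lat_refl pairing_refl_r [refl_lat a _]refl_latK.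
Qed.

Definition weyl_group : groupType := ggen (range refl_lat).
Lemma refl_lat_weyl a : refl_lat a \in gspan (range refl_lat).
Proof. by rewrite inE; apply: gspan_gen; exists a. Qed.
Definition weyl_refl (a : root) : weyl_group :=
  exist (fun x => x \in gspan _) (refl_lat a) (refl_lat_weyl a).

(* With a single root length every root is short and none is long. *)
Definition is_short (a : root) : Prop := forall b : root, dot a a <= dot b b.
Definition is_long (a : root) : Prop := ~ is_short a.
Definition simply_laced : Prop := forall a b : root, dot a a = dot b b.

(* The tuple s is a base of the root system; C i j is the value of the i-th simple
   coroot at the j-th simple root. *)
Definition has_cartan_matrix (l : nat) (C : 'M[int]_l) : Prop :=
  exists s : l.-tuple root,
    [/\ basis_of fullv (map root_val s),
        forall b : root, exists c : 'I_l -> nat,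
          root_val b = \sum_i root_val (tnth s i) *+ c i \/
          root_val b = - \sum_i root_val (tnth s i) *+ c i
      & forall i j, pairing (tnth s i) (root_lat (tnth s j)) = C i j].
End RootSystem.

Definition cartan_simply_laced (l : nat) (e : rel nat) : 'M[int]_l :=
  \matrix_(i, j) (if i == j then 2 else if e i j || e j i then -1 else 0).

Definition cartan_A (l : nat) : 'M[int]_l :=
  cartan_simply_laced l (fun i j => j == i.+1)%N.

(* The path 0 - 1 - ... - (l-2), with the node l-1 attached to the node l-3. *)
Definition cartan_D (l : nat) : 'M[int]_l :=
  cartan_simply_laced l (fun i j =>
    (j == i.+1) && (j < l.-1) || (i == l - 3) && (j == l.-1))%N.

(* The path 0 - 1 - ... - (l-2), with the node l-1 attached to the node 2. *)
Definition cartan_E (l : nat) : 'M[int]_l :=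
  cartan_simply_laced l (fun i j =>
    (j == i.+1) && (j < l.-1) || (i == 2) && (j == l.-1))%N.

Definition cartan_F4 : 'M[int]_4 :=
  \matrix_(i, j) (if (val i == 1)%N && (val j == 2)%N then -2 else cartan_A 4 i j).

Definition cartan_G2 : 'M[int]_2 :=
  \matrix_(i, j) (if (val i == 0)%N && (val j == 1)%N then -3 else cartan_A 2 i j).

(* B is a Z-basis; linear combinations run over duplicate-free lists in B. *)
Definition is_free_abelian (G : zmodType) : Prop :=
  exists B : set G, zspan B = setT /\
    forall (s : seq G) (c : G -> int), uniq s -> (forall x, x \in s -> B x) ->
      \sum_(x <- s) x *~ c x = 0 -> forall x, x \in s -> c x = 0.

Section Extended.
Variables (R : realType) (n : nat) (D : rootSystem R n) (G : zmodType).
Local Notation L := (root_lattice D).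
Implicit Types a b : G * root D.

Definition ext_refl_root a b : G * root D :=
  (b.1 - a.1 *~ pairing a.2 (root_lat b.2), refl_root a.2 b.2).

Definition ext_refl_fun a (x : G * L) : G * L :=
  (x.1 - a.1 *~ pairing a.2 x.2, refl_lat a.2 x.2).
Fact ext_reflK a : involutive (ext_refl_fun a).
Proof.
case: a => g a [h l]; congr (_, _); last exact: refl_latK.
by rewrite /= pairing_refl_self mulrNz opprK subrK.
Qed.
Fact ext_reflD a : {morph ext_refl_fun a : x y / x + y}.
Proof.
move=> x y; congr (_, _); last exact: refl_latD.
by rewrite /= pairingD mulrzDr opprD addrACA.
Qed.
Definition ext_refl a : aut (G * L)%type :=
  Aut (ext_reflK a) (ext_reflK a) (ext_reflD a).

Record extRootSystem := ExtRootSystem {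
  ers : set (G * root D);
  ers_R0 : forall a : root D, exists g, ers (g, a);
  ers_R1 : zspan [set g | exists a : root D, ers (g, a)] = setT;
  ers_R2 : forall a : root D, ers (0, a);
  ers_R3 : forall a b, ers a -> ers b -> ers (ext_refl_root a b)
}.

Lemma ext_reflE a h l : ext_refl a (h, l) = (h - a.1 *~ pairing a.2 l, refl_lat a.2 l).
Proof. by []. Qed.

Lemma ext_refl_inv a : (ext_refl a)^-1%g = ext_refl a. Proof. exact: autP. Qed.

Lemma ext_refl_conj a b :
  (ext_refl a * ext_refl b * (ext_refl a)^-1)%g = ext_refl (ext_refl_root a b).
Proof.
rewrite ext_refl_inv; apply: autP => -[h l]; rewrite !autME !ext_reflE /=.
congr (_, _); last exact: (refl_lat_conj a.2 b.2 l).
rewrite -(pairing_refl_r a.2 b.2 l) /=.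
set y := pairing b.2 _.
rewrite pairingB pairingMz pairing_refl_self.
rewrite mulrzBr mulrNz mulrzA mulrzBl.
set A := _ *~ pairing a.2 l; set B := b.1 *~ y; set C := _ *~ y.
by rewrite !opprD !opprK !addrA [_ - B + A]addrAC subrK.
Qed.

Variable Rx : extRootSystem.

(* The set of g with (g, a) in R depends only on the length of a, so these unions
   over the roots a of one length are the common values. *)
Definition S_sh : set G := [set g | exists2 a : root D, is_short a & ers Rx (g, a)].
Definition S_lg : set G := [set g | exists2 a : root D, is_long a & ers Rx (g, a)].

(* Only used for non-simply laced types, that is B, C, F4 (value 2) and G2. *)
Definition k_factor : nat := if `[< has_cartan_matrix D cartan_G2 >] then 3 else 2.

Definition is_direct_sum (G1 G2 : set G) : Prop :=
  [/\ is_zsubgroup G1, is_zsubgroup G2,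
      [set x + y | x in G1 & y in G2] = setT & G1 `&` G2 = [set 0]].

Definition is_twist_decomposition (G1 G2 : set G) : Prop :=
  [/\ is_direct_sum G1 G2,
      S_sh = [set x + y | x in S_sh `&` G1 & y in zspan (S_lg `&` G2)]
    & S_lg = [set x *+ k_factor + y | x in zspan (S_sh `&` G1) & y in S_lg `&` G2]].

Definition tame : Prop :=
  simply_laced D \/ exists G1 G2 : set G, is_twist_decomposition G1 G2.

Definition refl_sort : Type :=
  {t : aut (G * L)%type | exists2 a, ers Rx a & t = ext_refl a}.

Fact refl_op_subproof (s t : refl_sort) :
  exists2 a, ers Rx a & (sval s * sval t * (sval s)^-1)%g = ext_refl a.
Proof.
have [[a Ra ->] [b Rb ->]] := (svalP s, svalP t).
by exists (ext_refl_root a b); [exact: ers_R3|exact: ext_refl_conj].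
Qed.
Definition refl_op (s t : refl_sort) : refl_sort := exist _ _ (refl_op_subproof s t).

Lemma refl_sortP (s t : refl_sort) : sval s = sval t -> s = t.
Proof.
by case: s t => [s sP] [t tP] /= st; move: sP; rewrite st => sP; congr exist;
  apply: Prop_irrelevance.
Qed.

Lemma refl_sort_inv (s : refl_sort) : ((sval s)^-1)%g = sval s.
Proof. by have [a _ ->] := svalP s; apply: ext_refl_inv. Qed.

Lemma refl_sort2 (s : refl_sort) : (sval s * sval s)%g = 1%g.
Proof. by rewrite -{1}(refl_sort_inv s) mulVg. Qed.

Fact refl_opK s t : refl_op s (refl_op s t) = t.
Proof.
apply: refl_sortP => /=; rewrite refl_sort_inv !mulgA.
by rewrite refl_sort2 mul1g -mulgA refl_sort2 mulg1.
Qed.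
Fact refl_opD r s t : refl_op r (refl_op s t) = refl_op (refl_op r s) (refl_op r t).
Proof.
by apply: refl_sortP => /=; rewrite !invgM invgK !mulgA !mulgVK.
Qed.
Definition refl_system : symSystem := SymSystem refl_opK refl_opD.
Local Notation T := refl_system.

(* A chosen presentation [t = ext_refl a]; see [ext_refl_inj] for the choice
   being immaterial in the definitions of [reflK] and [reflV]. *)
Definition refl_repr (t : T) : G * root D := s2val (cid2 (svalP t)).
Lemma refl_reprR t : ers Rx (refl_repr t). Proof. by rewrite /refl_repr; case: cid2. Qed.
Lemma refl_reprE t : sval t = ext_refl (refl_repr t). Proof. by rewrite /refl_repr; case: cid2. Qed.

(* The element g (x) a^v of G (x) L^v, seen in Hom(L, G); the group K is generated
   by these elements inside the group of all functions from L to G. *)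
Definition tensor (g : G) (a : root D) : L -> G := fun l => g *~ pairing a l.

Definition Kset : set (L -> G) := [set tensor a.1 a.2 | a in ers Rx].
Definition Kgroup : zmodType := zgen Kset.
Implicit Types k : Kgroup.

Lemma tensor_K a : ers Rx a -> tensor a.1 a.2 \in zspan Kset.
Proof. by move=> Ra; rewrite inE; apply: zspan_gen; exists a. Qed.

Definition Kval k : L -> G := val k.
Lemma Kval_inj : injective Kval. Proof. exact: val_inj. Qed.
Lemma KvalB k k' l : Kval (k - k') l = Kval k l - Kval k' l. Proof. by []. Qed.
Lemma KvalD k k' l : Kval (k + k') l = Kval k l + Kval k' l. Proof. by []. Qed.

Lemma Kval_add k : {morph Kval k : x y / x + y}.
Proof.
have := set_mem (valP k); rewrite -/(Kval k).
apply: (@zspan_ind _ _ [set f : L -> G | {morph f : x y / x + y}])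
    => [_ [a _ <-]||f g fD gD] x y /=.
- by rewrite /tensor pairingD mulrzDr.
- by rewrite /= addr0.
- by rewrite [LHS]/(_ - _) /= fD gD opprD addrACA.
Qed.

Lemma tensor_refl g (a b : root D) l :
  tensor g b (refl_lat a l) = tensor g (refl_root a b) l.
Proof. by rewrite /tensor pairing_refl_r. Qed.

Lemma ext_refl_inj a b : ext_refl a = ext_refl b ->
  tensor a.1 a.2 = tensor b.1 b.2 /\ refl_lat a.2 = refl_lat b.2.
Proof.
move=> ab; have abl l : ext_refl a (0, l) = ext_refl b (0, l) by rewrite ab.
split; [apply/funext => l|apply: autP => l]; have := abl l.
  by move/(congr1 fst); rewrite /= !sub0r => /oppr_inj.
by move/(congr1 snd).
Qed.

Definition reflK (t : T) : Kgroup :=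
  exist (fun f => f \in zspan Kset) _ (tensor_K (refl_reprR t)).
Definition reflV (t : T) : weyl_group D := weyl_refl (refl_repr t).2.

Lemma reflKE t a : sval t = ext_refl a -> Kval (reflK t) = tensor a.1 a.2.
Proof. by rewrite refl_reprE => /ext_refl_inj[]. Qed.
Lemma reflVE t a : sval t = ext_refl a -> val (reflV t) = refl_lat a.2.
Proof. by rewrite refl_reprE => /ext_refl_inj[]. Qed.

Lemma Kset_refl (a : root D) (f : L -> G) :
  zspan Kset f -> zspan Kset (f \o refl_lat a).
Proof.
pose P : set (L -> G) := [set f : L -> G | zspan Kset (f \o refl_lat a)].
have [K0 KB] := zspan_sub Kset.
apply: (zspan_ind (P := P)) => [_ [b Rb <-]||g h gK hK]; rewrite /P /mkset.
- apply: zspan_gen; exists (ext_refl_root (0, a) b).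
    exact: ers_R3 (ers_R2 _ _) Rb.
  apply/funext => l; rewrite /ext_refl_root /= mul0rz subr0.
  exact/esym/tensor_refl.
- exact: K0.
- exact: KB gK hK.
Qed.

(* Since v.(g (x) m) = g (x) v.m, and the pairing is Weyl-invariant, v acts on
   Hom(L, G) by precomposition with its inverse; see [actK_tensor]. *)
Fact actK_subproof (v : weyl_group D) k :
  (fun l => Kval k ((val v)^-1%g l)) \in zspan Kset.
Proof.
rewrite inE; have := set_mem (valP k); rewrite -/(Kval k); move: (Kval k).
suff : [set w : aut L | forall f, zspan Kset f ->
    zspan Kset (f \o w) /\ zspan Kset (f \o aut_inv w)] (val v).
  by move=> /= + f fK => /(_ f fK)[].
have := set_mem (valP v); rewrite -/(val v).
apply: gspan_ind => [_ [a _ <-] f fK|f fK|x y xP yP f fK|x xP f fK] //=.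
- by have := Kset_refl a fK.
- split; first by have [/xP[/yP[]]] := (fK, tt).
  by have [/yP[_ /xP[_]]] := (fK, tt).
- by have [] := xP f fK.
Qed.
Definition actK (v : weyl_group D) k : Kgroup :=
  exist (fun f => f \in zspan Kset) _ (actK_subproof v k).

Lemma actKE v k l : Kval (actK v k) l = Kval k ((val v)^-1%g l). Proof. by []. Qed.
Lemma actK_tensor (a b : root D) k g : Kval k = tensor g b ->
  Kval (actK (weyl_refl a) k) = tensor g (refl_root a b).
Proof. by move=> kE; apply/funext => l; rewrite actKE kE -tensor_refl. Qed.

Lemma actK1 k : actK 1%g k = k. Proof. by apply: Kval_inj. Qed.
Lemma actKM v w k : actK (v * w)%g k = actK v (actK w k).
Proof. by apply: Kval_inj. Qed.
Lemma actKD v k k' : actK v (k + k') = actK v k + actK v k'.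
Proof. by apply: Kval_inj. Qed.

(* The element (k, v) of Hom(L, G) ><| Aut(L), as an automorphism of G x L. *)
Definition affine (k : Kgroup) (v : weyl_group D) : aut (G * L)%type.
Proof.
refine (@Aut _ (fun x => (x.1 + Kval k (val v x.2), val v x.2))
   (fun x => (x.1 - Kval k x.2, (val v)^-1%g x.2)) _ _ _).
- by move=> [h l]; rewrite /= aut_funK addrK.
- by move=> [h l]; rewrite /= aut_invK subrK.
- by move=> x y; congr (_, _); rewrite /= !aut_add // Kval_add addrACA.
Defined.

Lemma affineM k v k' v' :
  affine (k + actK v k') (v * v')%g = (affine k v * affine k' v')%g.
Proof.
have e l : Kval (actK v k') (val (v * v')%g l) = Kval k' (val v' l).
  by rewrite actKE; congr (Kval k' _); apply: aut_funK.
apply: autP => -[h l]; congr (_, _).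
change (h + Kval (k + actK v k') (val (v * v')%g l)
  = h + Kval k' (val v' l) + Kval k (val v (val v' l))).
by rewrite KvalD e -addrA [Kval k _ + _]addrC.
Qed.
Lemma affine1 : affine 0 1%g = 1%g.
Proof. by apply: autP => -[h l]; congr (_, _); rewrite /= addr0. Qed.
Lemma affine_refl t : affine (reflK t) (reflV t) = sval t.
Proof.
rewrite refl_reprE; apply: autP => -[h l]; congr (_, _).
set a := refl_repr t.
change (h + a.1 *~ pairing a.2 (l - root_lat a.2 *~ pairing a.2 l)
  = h - a.1 *~ pairing a.2 l).
by rewrite pairing_refl_self mulrNz.
Qed.

Record invariantBihom (Z : zmodType) := InvariantBihom {
  bih :> Kgroup -> Kgroup -> Z;
  bihDl : forall x y z, bih (x + y) z = bih x z + bih y z;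
  bihDr : forall x y z, bih x (y + z) = bih x y + bih x z;
  bih_alt : forall x, bih x x = 0;
  bih_inv : forall v x y, bih (actK v x) (actK v y) = bih x y
}.

Section ReflectionBihom.
Variables (Z : zmodType) (b : invariantBihom Z).

Fact bih0l x : b 0 x = 0.
Proof. by apply: (addrI (b 0 x)); rewrite -bihDl !addr0. Qed.
Fact bih0r x : b x 0 = 0.
Proof. by apply: (addrI (b x 0)); rewrite -bihDr !addr0. Qed.
Fact bihNl x y : b (- x) y = - b x y.
Proof. by apply: (addrI (b x y)); rewrite -bihDl !subrr bih0l. Qed.
Fact bihNr x y : b x (- y) = - b x y.
Proof. by apply: (addrI (b x y)); rewrite -bihDr !subrr bih0r. Qed.

Definition Kb : Type := (Z * Kgroup)%type.
HB.instance Definition _ := Choice.on Kb.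
Implicit Types p q : Kb.
Definition Kb_one : Kb := (0, 0).
Definition Kb_mul p q : Kb := (p.1 + q.1 + b p.2 q.2, p.2 + q.2).
Definition Kb_inv p : Kb := (- p.1, - p.2).
Fact Kb_mulA : associative Kb_mul.
Proof.
case=> [z x] [z' x'] [z'' x'']; congr (_, _); rewrite /= ?addrA // bihDl bihDr.
rewrite -!addrA; do 2!congr (_ + _).
by rewrite [RHS]addrCA; congr (_ + _); rewrite addrC -addrA.
Qed.
Fact Kb_mul1 : left_id Kb_one Kb_mul.
Proof. by case=> z x; congr (_, _); rewrite /= add0r // bih0l addr0. Qed.
Fact Kb_mulr1 : right_id Kb_one Kb_mul.
Proof. by case=> z x; congr (_, _); rewrite /= addr0 // bih0r addr0. Qed.
Fact Kb_mulV : left_inverse Kb_one Kb_inv Kb_mul.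
Proof.
by case=> z x; congr (_, _); rewrite /= addNr // bihNl bih_alt subr0.
Qed.
Fact Kb_mulrV : right_inverse Kb_one Kb_inv Kb_mul.
Proof.
by case=> z x; congr (_, _); rewrite /= subrr // bihNr bih_alt subr0.
Qed.
HB.instance Definition _ := isGroup.Build Kb Kb_mulA Kb_mul1 Kb_mulr1 Kb_mulV Kb_mulrV.

Definition actKb_fun (v : weyl_group D) p : Kb := (p.1, actK v p.2).
Fact actKb1 p : actKb_fun 1%g p = p.
Proof. by case: p => z k; congr (_, _); apply: actK1. Qed.
Fact actKbM v w p : actKb_fun (v * w)%g p = actKb_fun v (actKb_fun w p).
Proof. by rewrite /actKb_fun actKM. Qed.
Fact actKbMr v p q :
  actKb_fun v (p * q)%g = (actKb_fun v p * actKb_fun v q)%g.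
Proof.
case: p q => [z x] [z' y]; congr (_, _); last exact: actKD.
by rewrite /= bih_inv.
Qed.
Definition actKb : gaction (weyl_group D) Kb := GAction actKb1 actKbM actKbMr.

Definition refl_triple (t : T) : sdprod actKb := ((0, reflK t), reflV t).
Definition Ab : groupType := ggen (range refl_triple).
Fact refl_triple_Ab t : refl_triple t \in gspan (range refl_triple).
Proof. by rewrite inE; apply: gspan_gen; exists t. Qed.
Definition Ab_gen (t : T) : Ab :=
  exist (fun x => x \in gspan (range refl_triple)) _ (refl_triple_Ab t).

Definition Ab_proj (x : sdprod actKb) : aut (G * L)%type := affine x.1.2 x.2.
Lemma Ab_projM x y : Ab_proj (x * y)%g = (Ab_proj x * Ab_proj y)%g.
Proof. exact: affineM. Qed.
Lemma Ab_proj1 : Ab_proj 1%g = 1%g. Proof. exact: affine1. Qed.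
Lemma Ab_projV x : Ab_proj x^-1%g = ((Ab_proj x)^-1)%g.
Proof. by apply: (mulIg (Ab_proj x)); rewrite -Ab_projM !mulVg Ab_proj1. Qed.

Fact Ab_act_subproof (x : Ab) (t : T) :
  exists2 a, ers Rx a &
    (Ab_proj (val x) * sval t * (Ab_proj (val x))^-1)%g = ext_refl a.
Proof.
have := set_mem (valP x); rewrite -/(val x); move: (val x) => y yA.
pose P : set (sdprod actKb) := [set z | forall t : T, exists2 a, ers Rx a &
  (Ab_proj z * sval t * (Ab_proj z)^-1)%g = ext_refl a].
have PM z z' : P z -> P z' -> P (z * z')%g.
  move=> Pz Pz' s; have Ps := Pz' s; have [a Ra e] := Pz (exist _ _ Ps).
  by exists a => //; rewrite -e /= Ab_projM invgM !mulgA.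
have Pt s : P (refl_triple s) /\ P (refl_triple s)^-1%g.
  have pE : Ab_proj (refl_triple s) = sval s by exact: affine_refl.
  by split=> r; have := svalP (refl_op s r); rewrite /= ?Ab_projV pE ?refl_sort_inv.
pose Q : set (sdprod actKb) := [set z | P z /\ P z^-1%g].
suff : Q y by case=> /(_ t).
apply: (gspan_ind (P := Q)) yA => [_ [s _ <-]||z z' [Pz Pz'] [Pw Pw']|z [Pz Pz']].
- exact: Pt.
- suff P1 : P 1%g by split; rewrite ?invg1.
  by move=> s; rewrite Ab_proj1 invg1 mul1g mulg1; exact: svalP s.
- by split; rewrite ?invgM; apply: PM.
- by split; rewrite ?invgK.
Qed.

Definition Ab_act (x : Ab) (t : T) : T :=
  exist (fun f => exists2 a, ers Rx a & f = ext_refl a) _ (Ab_act_subproof x t).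

Definition is_reflection_bihom : Prop := is_reflection_group Ab_act Ab_gen.

Definition is_admissible : Prop :=
  is_reflection_bihom /\
  forall s t : T, reflV s <> reflV t -> (reflV s * reflV t = reflV t * reflV s)%g ->
    b (reflK s) (reflK t) = 0.

End ReflectionBihom.

Definition is_universal_admissible (Z : zmodType) (w : invariantBihom Z) : Prop :=
  is_admissible w /\
  forall (B : zmodType) (b : invariantBihom B), is_admissible b ->
    exists! f : Z -> B, zmod_morphism f /\ forall x y, b x y = f (w x y).

Definition ext_weyl_group (Z : zmodType) (w : invariantBihom Z)
  (hw : is_universal_admissible w) : reflGroup T :=
  ReflGroup hw.1.1.
End Extended.

(* Main.v *)
From HB Require Import structures.
Require Import Defs.
From mathcomp Require Import all_boot all_order all_algebra.
From mathcomp Require Import finmap boolp classical_sets functions reals.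
From mathcomp Require Import ring zify.
Set Implicit Arguments.
Unset Strict Implicit.
Unset Printing Implicit Defensive.
Import Order.TTheory GRing.Theory Num.Theory.
Local Open Scope ring_scope.
Local Open Scope classical_set_scope.

(** The group U is generated by the reflections r(g, a), (g, a) in R; write
    w_a = r(0, a) and x_a(g) = r(g, a) w_a.  The relations of U turn into
      x_a(g) x_c(h) x_{r_c a}(- g) = x_c(h + <a^v, c> g),
    and the w_a permute the families x_a.  An element of the kernel of U -> W is
    shown to be trivial in three steps.

    The failure of x_c to be additive is the defect
      F_c(g, h) = x_c(h - g) x_c(g) x_c(- h),
    and every commutator of elements x_a(g), x_c(h) is a value of F_c
    (xgen_comm).  When a and b span a subsystem of type A2, the relation becomes
    x(g) y(h) z(g) = y(h - g) for the three roots a, b, - (a + b) in any order,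
    and this symmetry forces F_a = F_b, centrality in the subgroup at hand, and
    biadditivity (the hexagon lemmas).  In the types of the theorem every root
    has such a neighbour b, and every pair of simple roots is linked in a way
    that makes all defects central in U (simple_defect_central).

    Hence each u in U is a central product of defects, times an ordered product
    of elements x_i(g_i) over the simple roots, times a word in the w_i
    (decomposition).  The words form a copy of the finite Weyl group, by the
    exchange argument (word_elt_faithful).

    For additive phi, psi : G -> R, the bihomomorphism on K with
      b(g (x) a^v, h (x) c^v) = (a^v, c^v) (phi g psi h - psi g phi h)
    is admissible (wedge_admissible), so it factors through the universal one and
    yields a homomorphism on U that is trivial on the kernel of U -> W
    (detection).  Its Weyl component removes the word, its K component removes
    the g_i, so that only a central product of defects is left
    (kernel_defect_group), and its central component gives linear conditions on
    that product.

    It remains to see that these conditions suffice.  With one root length, the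
    defect is one alternating map on G, a group with a basis, and such a map
    vanishes on a tensor killed by all phi /\ psi (alternating_eq0).  With two
    root lengths there are two alternating maps, F_sh on G and F_lg on the subgroup
    S_lg, related by F_lg(h, k g) = F_sh(h, g).  The twist decomposition
    G = G1 + G2, S_lg = k G1 + G2, allows them to be glued into a single alternating
    map on G whose values still generate all defects (twist_defect,
    two_length_kernel), and the same argument applies. *)

(** * Products of three factors with hexagonal symmetry *)

Ltac free_reduce := rewrite ?(invgM, invgK, mulgA, mulgK, mulgVK, mulVg, mulgV, mul1g, mulg1, invg1).

(** Measures how far [x] is from being additive: for a homomorphism it is 1. *)
Definition defect (U : groupType) (H : zmodType) (x : H -> U) (g h : H) : U :=
  (x (h - g)%R * x g * x (- h)%R)%g.

(** The three families stand for the roots a, b, - (a + b) of a system of type A2;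
    the relation [hex] is invariant under all permutations of the three. *)
Section Hexagon.
Variables (U : groupType) (H : zmodType) (X : 'I_3 -> H -> U).
Hypothesis X0 : forall i, X i 0 = 1%g.
Hypothesis XN : forall i g, X i (- g) = ((X i g)^-1)%g.
Hypothesis XX : forall i g h, (X i g * X i h * X i g)%g = X i (h + g + g).
Hypothesis hex : forall i j k g h, i != j -> j != k -> i != k ->
  (X i g * X j h * X k g)%g = X j (h - g).
Local Notation F i := (defect (X i)).
Local Open Scope group_scope.

Lemma third_index (i j : 'I_3) : exists k, (j != k) && (i != k).
Proof.
case: i j => [[|[|[|//]]] ?] [[|[|[|//]]] ?];
  first [ by exists (@Ordinal 3 0 isT) | by exists (@Ordinal 3 1 isT)
        | by exists (@Ordinal 3 2 isT)].
Qed.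

Lemma hex_comm i j g h : i != j ->
  X i g * X j h * (X i g)^-1 * (X j h)^-1 = F j g h.
Proof.
move=> ij; have [k /andP[jk ik]] := third_index i j.
have e : (X i g)^-1 = X k g * X j g.
  apply: (mulIg (X i g)); rewrite mulVg hex 1?eq_sym //.
  by rewrite subrr X0.
by rewrite e -(XN j h) mulgA (hex g h ij jk ik).
Qed.

(** The commutator of [X i g] and [X j h] can be computed as a word in the family
    [j], and, after exchanging the two, as a word in the family [i]. *)
Lemma hex_rot i j g h : i != j -> F j g h = X i g * X i (- h)%R * X i (h - g)%R.
Proof.
move=> ij; rewrite -(hex_comm g h ij).
have := hex_comm h g; move/(_ j i); rewrite eq_sym => /(_ ij) /(congr1 (fun u : U => u^-1)).
by rewrite /defect !invgM !invgK -!XN opprB opprK !mulgA => ->.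
Qed.

(** The case [i = j] is reached by passing through the two other indices. *)
Lemma hex_rotE i j g h : F j g h = X i g * X i (- h)%R * X i (h - g)%R.
Proof.
have [<-{j}|] := eqVneq i j; last exact: hex_rot.
have [j /andP[ij _]] := third_index i i; have [k /andP[jk ik]] := third_index i j.
rewrite eq_sym in jk; rewrite eq_sym in ik.
by rewrite (hex_rot g h ik) -(hex_rot g h jk) (hex_rot g h ij).
Qed.

Lemma hex_defectE i j g h : F i g h = F j g h.
Proof. by rewrite (@hex_rotE i i) -(@hex_rotE i j). Qed.

(** The defect equals a cyclic rotation of its defining word. *)
Lemma hex_defect_rot i g h : F i (h - g)%R (- g)%R = F i g h.
Proof.
rewrite (hex_rotE i) /defect opprK; congr (_ * _ * X i _).
by rewrite opprB addrA addNr add0r.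
Qed.

Lemma hex_defectV i j g h : (F i g h)^-1 = F j h g.
Proof. by rewrite (hex_rotE j) /defect !invgM -!XN opprB opprK mulgA. Qed.

(** With p = x (h - g), q = x g and r = x (- h), the words p q r, q r p and r p q
    have the same value, which therefore commutes with p, q and r. *)
Lemma hex_defect_commute_gh i j g h :
  commute (F i g h) (X j g) /\ commute (F i g h) (X j h).
Proof.
set p := X j (h - g)%R; set q := X j g; set r := X j (- h)%R.
have e1 : F i g h = p * q * r by rewrite (hex_defectE i j).
have e2 : F i g h = q * r * p by rewrite (hex_rotE j).
have e3 : F i g h = r * p * q.
  rewrite -hex_defect_rot (hex_defectE i j) /defect opprK; congr (X j _ * _ * _).
  by rewrite opprB addrA addNr add0r.
split; first by rewrite /commute {1}e2 e3 !mulgA.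
have -> : X j h = r^-1 by rewrite /r XN invgK.
by apply: commuteV; rewrite /commute {1}e3 e1 !mulgA.
Qed.

Lemma hex_defect_comm i j k g h : i != j ->
  F k g h = X i g * X j h * (X i g)^-1 * (X j h)^-1.
Proof. by move=> ij; rewrite hex_comm // (hex_defectE k j). Qed.

Lemma hex_defectNl k g h : F k (- g)%R h = (F k g h)^-1.
Proof.
have [j /andP[ij _]] := third_index k k.
have [/commuteV/commute_sym/commuteV/commute_sym c _] :=
  hex_defect_commute_gh k k g h.
have {c} -> : (F k g h)^-1 = (X k g)^-1 * (F k g h)^-1 * X k g.
  by apply/esym; rewrite -c; free_reduce.
by rewrite !(@hex_defect_comm k j k) // XN; free_reduce.
Qed.

Lemma hex_defectNr k g h : F k g (- h)%R = (F k g h)^-1.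
Proof. by rewrite -(hex_defectV k) hex_defectNl invgK (hex_defectV k k). Qed.

(** The right-hand side does not depend on [i]: all three families act in the
    same way on the defects. *)
Lemma hex_defect_conj i l k g h :
  X i k * F l g h * (X i k)^-1 = F l (g - k - k)%R h * F l (k + k)%R h.
Proof.
rewrite !(hex_defectE l i).
have -> : F i (k + k)%R h = X i h * X i (k + k - h)%R * X i (- (k + k))%R.
  rewrite -[LHS]invgK -hex_defectNl -hex_defectNr -hex_defect_rot /defect !opprK.
  by congr (X i _ * X i _ * _); [rewrite opprD opprK addrCA subrr addr0|rewrite addrC].
rewrite /defect.
have -> : X i (h - (g - k - k))%R = X i k * X i (h - g)%R * X i k.
  by rewrite XX !opprD !opprK !addrA.
have -> : X i (g - k - k)%R = (X i k)^-1 * X i g * (X i k)^-1 by rewrite -XN XX.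
have -> : X i (k + k - h)%R = X i k * (X i h)^-1 * X i k.
  by rewrite -XN XX addrC addrA.
have -> : X i (- (k + k))%R = (X i k)^-1 * (X i k)^-1.
  by rewrite XN -[(k + k)%R]add0r addrA -XX X0 mulg1 invgM.
by rewrite XN; free_reduce.
Qed.

(** Conjugations by [X i k] and [X i (- k)] agree on defects, as the defect is even
    in (g, h), so the square of [X i k] centralises them.  So does its cube: the
    three families act alike, and [X i k * X j k * X m k = 1]. *)
Lemma hex_defect_commute i l g h k : commute (F l g h) (X i k).
Proof.
have c2 : commute (F l g h) (X i k * X i k).
  have e : X i k * F l g h * (X i k)^-1 = (X i k)^-1 * F l g h * X i k.
    have := hex_defect_conj i l (- k)%R (- g)%R (- h)%R.
    rewrite hex_defectNl hex_defectNr invgK XN invgK => ->.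
    by rewrite !hex_defectNr -!hex_defectNl hex_defect_conj !opprD !opprK.
  move: (F l g h) e => f /(congr1 (fun u => X i k * u * X i k)); free_reduce => e.
  by rewrite /commute mulgA e.
have c3 : commute (F l g h) (X i k * X i k * X i k).
  have [j /andP[ij _]] := third_index i i; have [m /andP[jm im]] := third_index i j.
  have e := hex k k ij jm im; rewrite subrr X0 in e.
  pose c n u := X n k * u * (X n k)^-1.
  have cM n u v : c n (u * v) = c n u * c n v by rewrite /c; free_reduce.
  have cE n p : c n (F l p h) = F l (p - k - k)%R h * F l (k + k)%R h.
    exact: hex_defect_conj.
  have : c i (c j (c m (F l g h))) = c i (c i (c i (F l g h))).
    by rewrite !(cE, cM).
  move: (F l g h) => f; rewrite /c.
  have -> : X i k * (X j k * (X m k * f * (X m k)^-1) * (X j k)^-1) * (X i k)^-1 =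
      (X i k * X j k * X m k) * f * (X i k * X j k * X m k)^-1 by free_reduce.
  rewrite e; free_reduce => /(congr1 (fun u => u * (X i k * X i k * X i k))).
  by rewrite /commute; free_reduce => ->.
have -> : X i k = (X i k * X i k)^-1 * (X i k * X i k * X i k) by free_reduce.
by apply: commuteM => //; apply: commuteV.
Qed.

Lemma hex_defectgg i g : F i g g = 1.
Proof. by rewrite /defect subrr X0 XN mul1g mulgV. Qed.

(** As defects are central, the commutator with [X j h] is multiplicative. *)
Lemma hex_defectDl i g g' h : F i (g + g')%R h = F i g h * F i g' h.
Proof.
have [j /andP[ij _]] := third_index i i.
have e : X i g * X i g' = F i g' (g + g')%R * X i (g + g')%R.
  by rewrite /defect addrK XN; free_reduce.
have c k := @hex_defect_commute k i g' (g + g')%R.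
have c1 : commute _ _ := @hex_defect_commute i i g' h g.
transitivity ((X i g * X i g') * X j h * (X i g * X i g')^-1 * (X j h)^-1).
  rewrite e (@hex_defect_comm i j i (g + g')%R) //.
  move: (F i g' _) (c i (g + g')%R) (c j h) => f.
  move: (X i _) (X j h) => a b ci cj.
  by rewrite ci; free_reduce; rewrite -[a * f * b]mulgA cj; free_reduce.
have e1 := @hex_defect_comm i j i g' h ij.
have e2 := @hex_defect_comm i j i g h ij.
have cf : commute (F i g' h) (F i g h).
  by rewrite {2}/defect; do 2?apply: commuteM; apply: hex_defect_commute.
transitivity (X i g * F i g' h * (X i g)^-1 * F i g h); first by rewrite e1 e2; free_reduce.
move: (F i g' h) c1 cf => f c1 cf; move: (X i g) (F i g h) c1 cf => a u c1 cf.
by rewrite -c1; free_reduce.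
Qed.

Lemma hex_mul i p q : X i p * X i q = F i q p * X i (p + q)%R.
Proof.
have -> : F i q p = F i q (p + q)%R.
  rewrite -(hex_defectV i i (p + q)%R) hex_defectDl hex_defectgg mulg1.
  exact/esym/hex_defectV.
by rewrite /defect addrK XN; free_reduce.
Qed.
End Hexagon.

(** * Roots and Cartan integers *)
Section Roots.
Variables (R : realType) (n : nat) (D : rootSystem R n).
Implicit Types a b c : Defs.root D.

Definition cartan a b : int := pairing a (root_lat b).

Lemma root_eq a b : root_val a = root_val b -> a = b.
Proof. by move=> ab; apply: val_inj. Qed.

Lemma cartanE a b : (cartan a b)%:~R = dot (coroot (root_val a)) (root_val b).
Proof. exact: pairingE. Qed.

Lemma refl_root_val a b :
  root_val (refl_root a b) = root_val b - (cartan a b)%:~R *: root_val a.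
Proof. by rewrite cartanE. Qed.

Lemma cartan_self a : cartan a a = 2. Proof. exact: pairing_root. Qed.

Lemma refl_rootK a : involutive (refl_root a).
Proof.
move=> b; apply: root_eq.
have := congr1 (@lat_val R n D) (refl_latK a (root_lat b)).
rewrite -[X in lat_val X = _]/(refl_lat a (refl_lat a (root_lat b))).
by rewrite -!root_lat_refl.
Qed.

Lemma cartan_reflr a b : cartan a (refl_root a b) = - cartan a b.
Proof. by rewrite /cartan root_lat_refl; exact: pairing_refl_self. Qed.

Lemma refl_root_conj c a b :
  refl_root c (refl_root a b) = refl_root (refl_root c a) (refl_root c b).
Proof.
apply: root_eq; have e := refl_lat_conj c a (refl_lat c (root_lat b)).
have := congr1 (@lat_val R n D) e.
by rewrite [refl_lat c (refl_lat c _)]refl_latK -!root_lat_refl.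
Qed.

Lemma cartan_sym a b : dot (root_val a) (root_val a) * (cartan a b)%:~R =
  dot (root_val b) (root_val b) * (cartan b a)%:~R.
Proof.
have h c d : dot (root_val c) (root_val c) * (cartan c d)%:~R =
    2 * dot (root_val c) (root_val d).
  by rewrite cartanE dotZl mulrCA mulrA mulfVK // root_normN0.
by rewrite !h dotC.
Qed.

Lemma cartan_eq0 a b : cartan a b = 0 -> cartan b a = 0.
Proof.
move=> ab; apply/eqP; rewrite -(intr_eq0 R); have := cartan_sym a b.
by rewrite ab mulr0 => /esym/eqP; rewrite mulf_eq0 (negPf (root_normN0 b)).
Qed.

Lemma pairing_refl_l c a l :
  pairing (refl_root c a) l = pairing a l - cartan a c * pairing c l.
Proof. by rewrite -pairing_refl_r -pairingMz -pairingB. Qed.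

Definition opp_root a := refl_root a a.
Lemma opp_root_val a : root_val (opp_root a) = - root_val a.
Proof.
by rewrite refl_root_val cartan_self -[2%:~R]/(1 + 1) scalerDl !scale1r opprD addrA subrr add0r.
Qed.
(** Such roots have the same length and generate a subsystem of type A2. *)
Definition adjacent a b := cartan a b = -1 /\ cartan b a = -1.

Definition triangle a b c := root_val a + root_val b + root_val c = 0 /\
  [/\ cartan a b = -1, cartan b a = -1, cartan a c = -1, cartan c a = -1 &
      cartan b c = -1 /\ cartan c b = -1].

Lemma cartanDr a b c d : root_val d = root_val b + root_val c ->
  cartan a d = cartan a b + cartan a c.
Proof.
by move=> e; apply: (@intr_inj R); rewrite rmorphD /= !cartanE e dotDr.
Qed.
Lemma cartanNr a b : cartan a (opp_root b) = - cartan a b.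
Proof.
by apply: (@intr_inj R); rewrite rmorphN /= !cartanE opp_root_val dotNr.
Qed.
Lemma cartanNl a b : cartan (opp_root a) b = - cartan a b.
Proof. by rewrite /cartan pairing_refl_l -/(cartan a a) cartan_self mulrDl mul1r opprD addrA subrr add0r. Qed.

Lemma adjacent_refl_val a b : adjacent a b ->
  root_val (refl_root a b) = root_val a + root_val b.
Proof. by case=> ab _; rewrite refl_root_val ab scaleN1r opprK addrC. Qed.

Lemma adjacent_triangle a b : adjacent a b ->
  triangle a b (opp_root (refl_root a b)).
Proof.
move=> adj; have v := adjacent_refl_val adj; case: (adj) => ab ba.
have h d : cartan d (refl_root a b) = cartan d a + cartan d b by exact: cartanDr.
have aab : cartan a (refl_root a b) = 1 by rewrite h ab cartan_self.
have bab : cartan b (refl_root a b) = 1 by rewrite h ba cartan_self.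
have k d : cartan (refl_root a b) d = cartan b d + cartan a d.
  by rewrite /cartan pairing_refl_l -/(cartan b a) ba mulN1r opprK.
split; first by rewrite opp_root_val v subrr.
by rewrite !cartanNr !cartanNl !k aab bab ab ba !cartan_self.
Qed.

Lemma triangle_perm a b c : triangle a b c -> triangle b a c /\ triangle a c b.
Proof.
move=> [s [ab ba ac ca [bc cb]]]; split; split=> //; first by rewrite (addrC (root_val b)).
by rewrite addrAC.
Qed.

Lemma triangle_refl a b c : triangle a b c -> refl_root b a = opp_root c.
Proof.
move=> [s [_ ba _ _ _]]; apply: root_eq; rewrite opp_root_val refl_root_val ba.
by rewrite scaleN1r opprK; apply/eqP; rewrite -addr_eq0 s.
Qed.
(** The root [d] has the same defect as [a], and this defect visibly commutes
    with the reflections attached to [b]; see [simple_defect_commute]. *)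
Definition linked a b := exists d, (d = a \/ adjacent a d) /\ (d = b \/ cartan d b = 0).

Local Notation norm a := (dot (root_val a) (root_val a)).

Lemma cartan_refl_r a b c : cartan a (refl_root c b) = cartan a b - cartan a c * cartan c b.
Proof.
rewrite /cartan root_lat_refl -[refl_lat c _]/(root_lat b - root_lat c *~ cartan c b).
by rewrite pairingB pairingMz.
Qed.

Lemma cartan_refl_l a b c : cartan (refl_root c a) b = cartan a b - cartan a c * cartan c b.
Proof. exact: pairing_refl_l. Qed.

Lemma norm_gt0 a : 0 < norm a.
Proof. rewrite lt_def root_normN0 sumr_ge0 // => j _; exact: sqr_ge0. Qed.

Lemma adjacent_norm a b : adjacent a b -> norm a = norm b.
Proof.
move=> [ab ba]; have := cartan_sym a b; rewrite ab ba.
by apply: mulIf; rewrite intr_eq0.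
Qed.

Lemma adjacent_sym a b : adjacent a b -> adjacent b a.
Proof. by case. Qed.

(** In type G2 no two simple roots are adjacent, but each of them is adjacent to
    its image under the other simple reflection. *)
Lemma g2_neighbour a b : cartan a b * cartan b a = 3 -> adjacent a (refl_root b a).
Proof.
by move=> ab; split; rewrite (cartan_refl_r, cartan_refl_l) ?ab cartan_self.
Qed.

(** For simple roots a (short) and b (long) of G2, d is the negative of the short
    root 2 a + b, orthogonal to b; with the lengths exchanged, 2 a + b is replaced by
    2 a + 3 b. *)
Lemma g2_link a b : cartan a b * cartan b a = 3 ->
  let d := opp_root (refl_root a (refl_root b a)) in adjacent a d /\ cartan d b = 0.
Proof.
move=> ab /=; have [h1 h2] := g2_neighbour ab.
rewrite /adjacent cartanNr !cartanNl cartan_reflr !(cartan_refl_l _ _ a) h1 h2 cartan_self.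
rewrite cartan_refl_l cartan_self; split; first by [].
by ring.
Qed.
End Roots.

(** * Reflections and translations in a reflection group *)
Section ReflectionGroup.
Variables (R : realType) (n : nat) (D : rootSystem R n) (G : zmodType).
Variables (Rx : extRootSystem D G) (U : reflGroup (refl_system Rx)).
Implicit Types (a b c : Defs.root D) (g h k : G).
Local Notation T := (refl_system Rx).

Definition refl_elt (a : G * Defs.root D) (Ra : ers Rx a) : T :=
  exist (fun t => exists2 a, ers Rx a & t = ext_refl a) (ext_refl a)
    (ex_intro2 _ _ a Ra erefl).

(** Indexed by all pairs, with value 1 outside of R, so that relations can be stated
    without proofs of membership in the arguments. *)
Definition rgen (g : G) a : U :=
  if pselect (ers Rx (g, a)) is left Ra then rg_gen U (refl_elt Ra) else 1%g.

Definition slice a : set G := [set g | ers Rx (g, a)].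

Lemma rgenE g a (Ra : ers Rx (g, a)) : rgen g a = rg_gen U (refl_elt Ra).
Proof.
by rewrite /rgen; case: pselect => // Ra'; congr (rg_gen U (refl_elt _)); apply: Prop_irrelevance.
Qed.

Lemma rg_gen_rgen (t : T) : exists g a, slice a g /\ rg_gen U t = rgen g a.
Proof.
have [[g a] Ra e] := svalP t; exists g, a; split=> //.
by rewrite (rgenE Ra); congr rg_gen; apply: refl_sortP.
Qed.

Lemma slice0 a : slice a 0. Proof. exact: ers_R2. Qed.
Hint Resolve slice0 : core.

Lemma slice_refl a b h : slice b h -> slice (refl_root a b) h.
Proof.
move=> Sh; have := ers_R3 (slice0 a) Sh.
by rewrite /ext_refl_root /= mul0rz subr0.
Qed.
Hint Resolve slice_refl : core.

Lemma slice_reflE a b : slice (refl_root a b) = slice b.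
Proof.
apply/seteqP; split=> h; last exact: slice_refl.
by move/(slice_refl a); rewrite refl_rootK.
Qed.

Lemma slice_shift a b g h : slice a g -> slice b h -> slice b (h - g *~ cartan a b).
Proof. by move=> Sg Sh; rewrite -(slice_reflE a); exact: (ers_R3 Sg Sh). Qed.

Lemma sliceN a g : slice a g -> slice a (- g).
Proof.
move=> Sg; have := slice_shift Sg Sg.
by rewrite cartan_self -[g *~ 2]/(g + g) opprD addrA subrr add0r.
Qed.
Hint Resolve sliceN : core.

Lemma rgen2 a g : slice a g -> (rgen g a * rgen g a)%g = 1%g.
Proof. by move=> Sg; rewrite (rgenE Sg); exact: rg_G4 (rg_prop U) _. Qed.

Lemma rgenV a g : slice a g -> ((rgen g a)^-1)%g = rgen g a.
Proof. by move=> /rgen2/mulg1_eq. Qed.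

Lemma rgenJ a b g h : slice a g -> slice b h ->
  (rgen g a * rgen h b * (rgen g a)^-1)%g = rgen (h - g *~ cartan a b) (refl_root a b).
Proof.
move=> Sg Sh; have Sab := ers_R3 Sg Sh.
rewrite (rgenE Sg) (rgenE Sh) (rgenE Sab) (rg_G3 (rg_prop U)); congr rg_gen.
by apply: refl_sortP; exact: (ext_refl_conj (g, a) (h, b)).
Qed.

Lemma rgenN a g : slice a g -> rgen (- g) (opp_root a) = rgen g a.
Proof.
move=> Sg; have := rgenJ Sg Sg; rewrite mulgK => ->.
by rewrite cartan_self -[g *~ 2]/(g + g) opprD addrA subrr add0r.
Qed.

Definition wgen a : U := rgen 0 a.
Definition xgen a g : U := (rgen g a * wgen a)%g.
Local Notation w := wgen.
Local Notation x := xgen.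
Local Open Scope group_scope.

Lemma wgen2 a : w a * w a = 1. Proof. exact: rgen2. Qed.
Lemma wgenV a : (w a)^-1 = w a. Proof. exact: rgenV. Qed.
Lemma xgen0 a : x a 0 = 1. Proof. exact: wgen2. Qed.

Lemma wgenJr a b g : slice b g -> w a * rgen g b * (w a)^-1 = rgen g (refl_root a b).
Proof. by move=> Sg; rewrite rgenJ // mul0rz subr0. Qed.
Lemma wgenJ a b : w a * w b * (w a)^-1 = w (refl_root a b).
Proof. exact: wgenJr. Qed.
Lemma wgen_opp a : w (opp_root a) = w a.
Proof. by rewrite -wgenJ mulgK. Qed.

Lemma xgenJ a b g : slice b g -> w a * x b g * (w a)^-1 = x (refl_root a b) g.
Proof.
move=> Sg; rewrite /xgen -wgenJr // -wgenJ; free_reduce.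
done.
Qed.

Lemma xgenN_opp a g : slice a g -> x (opp_root a) (- g)%R = x a g.
Proof. by move=> Sg; rewrite /xgen rgenN // wgen_opp. Qed.

Lemma xgenV a g : slice a g -> x a (- g)%R = (x a g)^-1.
Proof.
move=> Sg; rewrite -xgenN_opp ?opprK; last exact: sliceN.
rewrite -xgenJ // /xgen invgM wgenV rgenV //.
by free_reduce; rewrite -[_ * w a * w a]mulgA wgen2 mulg1.
Qed.

(** This is the conjugation relation r(g, a) r(h, r_a c) r(g, a) = r(h + m g, c), where
    m = <a^v, c>, after both sides are written with translations. *)
Lemma xgen_rel a c g h : slice a g -> slice c h ->
  x a g * x c h * x (refl_root c a) (- g)%R = x c (h + g *~ cartan a c)%R.
Proof.
move=> Sg Sh.
have Sh' : slice (refl_root a c) h by exact: slice_refl.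
have := rgenJ Sg Sh'; rewrite refl_rootK cartan_reflr mulrNz opprK => e.
rewrite [RHS]/xgen -{}e xgenV; last exact: slice_refl.
rewrite -(xgenJ c Sg) -(wgenJr a Sh) /xgen !invgM !invgK !mulgA.
have w2a u b : u * w b * w b = u by rewrite -mulgA wgen2 mulg1.
by rewrite w2a !(wgenV c).
Qed.

(** All commutators of translations are defects: this is what makes the
    subgroup of translations nilpotent once the defects are central. *)
Lemma xgen_comm a c g h : slice a g -> slice c h ->
  x a g * x c h * (x a g)^-1 * (x c h)^-1 = defect (x c) (- g *~ cartan a c)%R h.
Proof.
move=> Sg Sh; have e0 := xgen_rel Sg (slice0 c).
have e := xgen_rel Sg Sh; rewrite add0r xgen0 mulg1 in e0.
have Sm : slice c (g *~ cartan a c).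
  have := slice_shift (sliceN Sg) (slice0 c).
  by rewrite mulNrz opprK add0r.
rewrite /defect mulNrz opprK (xgenV Sm) (xgenV Sh) -e -e0.
by free_reduce.
Qed.

Lemma xgen_orth a c g h : cartan a c = 0%R -> slice a g -> slice c h ->
  commute (x a g) (x c h).
Proof.
move=> ac Sg Sh; have := xgen_rel Sg Sh.
have -> : refl_root c a = a.
  by apply: root_eq; rewrite refl_root_val (cartan_eq0 ac) scale0r subr0.
by rewrite ac mulr0z addr0 xgenV // => e; rewrite /commute -{2}e; free_reduce.
Qed.

Lemma slice_adjacent a b : adjacent a b -> slice a = slice b.
Proof.
move=> adj; rewrite -(slice_reflE b a) -(slice_reflE a b); congr slice.
have adj' : adjacent b a by case: adj.
by apply: root_eq; rewrite (adjacent_refl_val adj) (adjacent_refl_val adj') addrC.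
Qed.

(** A root with a neighbour lies in a system of type A2, so that the hexagon lemmas
    apply to its translations. *)
Section Neighbour.
Variables (a b : Defs.root D).
Hypothesis adj : adjacent a b.

(** For adjacent roots, r(g, b) sends (h, a) to (h + g, a + b), and a + b is conjugate
    to a. *)
Lemma slice_subgroup : is_zsubgroup (slice a).
Proof.
split=> // g h Sg Sh; have /sliceN Sh' := Sh; rewrite (slice_adjacent adj) in Sh'.
by have := slice_shift Sh' Sg; case: adj => _ ->; rewrite mulrNz opprK.
Qed.

(* The slice as a group in its own right, so that the hexagon lemmas, which are about
   total families, can be instantiated. *)
Let H := zgen (slice a).
Let c := opp_root (refl_root a b).

Lemma slice_zgen (g : H) : slice a (val g).
Proof. by have := set_mem (valP g); apply=> //; split; [exact: slice_subgroup|]. Qed.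

Let X (i : 'I_3) (g : H) : U := x (tnth [tuple a; b; c] i) (val g).

Lemma triangle_tnth (i j k : 'I_3) : i != j -> j != k -> i != k ->
  triangle (tnth [tuple a; b; c] i) (tnth [tuple a; b; c] j) (tnth [tuple a; b; c] k).
Proof.
have t1 : triangle a b c by exact: adjacent_triangle.
have [t2 t3] := triangle_perm t1; have [_ t4] := triangle_perm t2.
have [t5 _] := triangle_perm t3; have [_ t6] := triangle_perm t5.
by case: i j k => [[|[|[|//]]] ?] [[|[|[|//]]] ?] [[|[|[|//]]] ?].
Qed.

Lemma triangle_adjacent a' b' c' : triangle a' b' c' -> adjacent a' b'.
Proof. by move=> [_ []]. Qed.

Lemma slice_tnth i : slice (tnth [tuple a; b; c] i) = slice a.
Proof.
have [->//|i0] := eqVneq i ord0.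
have [k /andP[ik ok]] := third_index ord0 i; rewrite eq_sym in i0.
exact/esym/slice_adjacent/triangle_adjacent/(triangle_tnth i0 ik ok).
Qed.

Let slice_X i (g : H) : slice (tnth [tuple a; b; c] i) (val g).
Proof. by rewrite slice_tnth; exact: slice_zgen. Qed.

Let X0 i : X i 0 = 1. Proof. exact: xgen0. Qed.
Let XN i (g : H) : X i (- g)%R = (X i g)^-1.
Proof. exact: xgenV. Qed.
Let XX i (g h : H) : X i g * X i h * X i g = X i (h + g + g)%R.
Proof.
have := xgen_rel (slice_X i g) (slice_X i h).
rewrite cartan_self -/(opp_root _) xgenN_opp // => ->.
by rewrite /X; congr x; rewrite -addrA.
Qed.
Let hex (i j k : 'I_3) (g h : H) : i != j -> j != k -> i != k ->
  X i g * X j h * X k g = X j (h - g)%R.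
Proof.
move=> ij jk ik; have t := triangle_tnth ij jk ik.
have := xgen_rel (slice_X i g) (slice_X j h).
rewrite (triangle_refl t) xgenN_opp //.
by case: t => _ [-> _ _ _ _]; rewrite mulrNz.
Qed.

Let ia : 'I_3 := @Ordinal 3 0 isT.
Let ib : 'I_3 := @Ordinal 3 1 isT.
Local Notation F a := (defect (x a)).

Section Slice.
Variables (g h : G).
Hypotheses (Sg : slice a g) (Sh : slice a h).
Let zs k : slice a k -> k \in zspan (slice a).
Proof. by move=> Sk; rewrite inE; exact: zspan_gen. Qed.
Let gz : H := exist _ g (zs Sg).
Let hz : H := exist _ h (zs Sh).

Lemma adjacent_defect : F a g h = F b g h.
Proof. exact: (hex_defectE X0 XN hex ia ib gz hz). Qed.

Lemma adjacent_commute k : slice a k ->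
  commute (F a g h) (x a k) /\ commute (F a g h) (x b k).
Proof.
move=> Sk; pose kz : H := exist _ k (zs Sk).
by split; [exact: (hex_defect_commute X0 XN XX hex ia ia gz hz kz)
          |exact: (hex_defect_commute X0 XN XX hex ib ia gz hz kz)].
Qed.

Lemma defectDl k : slice a k -> F a (g + k)%R h = F a g h * F a k h.
Proof.
move=> Sk; pose kz : H := exist _ k (zs Sk).
exact: (hex_defectDl X0 XN XX hex ia gz kz hz).
Qed.

Lemma defectV : (F a g h)^-1 = F a h g.
Proof. exact: (hex_defectV X0 XN hex ia ia gz hz). Qed.

Lemma defectNN : F a (- g)%R (- h)%R = F a g h.
Proof.
have e := hex_defectNl X0 XN hex ia gz (- hz); by rewrite [X in _ = X^-1](hex_defectNr X0 XN hex) invgK in e.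
Qed.

Lemma defectgg : F a g g = 1.
Proof. exact: (hex_defectgg X0 XN ia gz). Qed.

Lemma xgen_mul : x a g * x a h = F a h g * x a (g + h)%R.
Proof. exact: (hex_mul X0 XN XX hex ia gz hz). Qed.
End Slice.
End Neighbour.
End ReflectionGroup.

(** * Bases and words in the simple reflections *)
Section Base.
Variables (R : realType) (n : nat) (D : rootSystem R n).
Variables (l : nat) (s : l.-tuple (Defs.root D)).
Implicit Types a b c : Defs.root D.

Definition is_base : Prop :=
  basis_of fullv (map (@root_val R n D) s) /\
  forall b, exists c : 'I_l -> nat,
    root_val b = \sum_i root_val (tnth s i) *+ c i \/
    root_val b = - \sum_i root_val (tnth s i) *+ c i.

Local Notation sg := (tnth s).
Let st : l.-tuple 'rV[R]_n := [tuple of map (@root_val R n D) s].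

Definition scoord (i : 'I_l) (b : Defs.root D) : R := coord st i (root_val b).

Definition positive b : Prop := forall i, 0 <= scoord i b.

Fixpoint act_word (t : seq 'I_l) b : Defs.root D :=
  if t is i :: t' then refl_root (sg i) (act_word t' b) else b.

Lemma act_word_cat t t' b : act_word (t ++ t') b = act_word t (act_word t' b).
Proof. by elim: t => //= i t ->. Qed.

Lemma act_word_refl t a b :
  act_word t (refl_root a b) = refl_root (act_word t a) (act_word t b).
Proof. by elim: t => //= i t ->; rewrite refl_root_conj. Qed.

Hypothesis base : is_base.

Let free_st : free st.
Proof. by case: base => + _; apply: basis_free. Qed.

Lemma scoord_simple i j : scoord i (sg j) = (i == j)%:R.
Proof.
by rewrite /scoord -tnth_map (tnth_nth 0) coord_free // eq_sym -val_eqE.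
Qed.

Lemma scoord_refl i j b : scoord j (refl_root (sg i) b) =
  scoord j b - (cartan (sg i) b)%:~R * (j == i)%:R.
Proof. by rewrite -scoord_simple /scoord refl_root_val linearB linearZ. Qed.

Lemma scoord_opp i b : scoord i (opp_root b) = - scoord i b.
Proof. by rewrite /scoord opp_root_val linearN. Qed.

Lemma scoord_sum b : root_val b = \sum_i scoord i b *: root_val (sg i).
Proof.
have b_st : root_val b \in <<st>>%VS by case: base => /span_basis-> _; exact: memvf.
rewrite {1}(coord_span b_st); apply: eq_bigr => i _.
by rewrite -tnth_map (tnth_nth 0).
Qed.

Lemma positive_or_opp b : positive b \/ positive (opp_root b).
Proof.
have h (c : 'I_l -> nat) i : 0 <= coord st i (\sum_i root_val (sg i) *+ c i).
  rewrite linear_sum sumr_ge0 // => j _; rewrite raddfMn /=.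
  by rewrite -[coord _ _ _]/(scoord i (sg j)) scoord_simple mulrn_wge0.
case: base => _ /(_ b)[c [e|e]]; [left|right] => i; rewrite ?scoord_opp /scoord e.
  exact: h.
by rewrite linearN opprK; exact: h.
Qed.

Lemma positive_simple i : positive (sg i).
Proof. by move=> j; rewrite scoord_simple ler0n. Qed.

(** The reflection in [sg i] changes only the coefficient of [sg i], and a positive root
    other than [sg i] has a positive coefficient elsewhere. *)
Lemma positive_refl i b : positive b -> b <> sg i -> positive (refl_root (sg i) b).
Proof.
move=> bp bi; have [//|dn] := positive_or_opp (refl_root (sg i) b).
have z j : j != i -> scoord j b = 0.
  move=> ji; apply/eqP; rewrite eq_le bp andbT; have := dn j.
  by rewrite scoord_opp scoord_refl (negPf ji) mulr0 subr0 oppr_ge0.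
have e : root_val b = scoord i b *: root_val (sg i).
  by rewrite {1}scoord_sum (bigD1 i) //= big1 ?addr0 // => j /z ->; rewrite scale0r.
have := root_mem b; rewrite e => /(root_reduced (root_mem (sg i))) [] e1.
  by case: bi; apply: root_eq; rewrite e e1 scale1r.
by have := bp i; rewrite e1 lerNr oppr0 ler10.
Qed.

(** Otherwise the scalar square of [b] would be a sum of nonpositive terms. *)
Lemma positive_descent b : positive b -> exists i, 0 < cartan (sg i) b.
Proof.
move=> bp; apply: contrapT => /forallNP neg.
have : 0 < dot (root_val b) (root_val b).
  rewrite lt_def root_normN0 sumr_ge0 // => i _; exact: sqr_ge0.
apply/negP; rewrite -leNgt {1}scoord_sum.
have -> : dot (\sum_i scoord i b *: root_val (sg i)) (root_val b) =
    \sum_i scoord i b * dot (root_val (sg i)) (root_val b).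
  rewrite (big_morph (fun v => dot v (root_val b)) (id1 := 0) (op1 := +%R)).
  - by apply: eq_bigr => i _; rewrite dotZl.
  - by move=> u v; rewrite dotDl.
  - by rewrite dotC dot0r.
apply: sumr_le0 => i _; apply: mulr_ge0_le0; first exact: bp.
have /negP := neg i; rewrite -leNgt -(ler_int R) cartanE dotZl => ci.
have n0 : 0 < dot (root_val (sg i)) (root_val (sg i)).
  rewrite lt_def root_normN0 sumr_ge0 // => j _; exact: sqr_ge0.
by move: ci; rewrite pmulr_rle0 // divr_gt0.
Qed.

(** Descent on the height: a positive root that is not simple is lowered by some
    simple reflection and stays positive. *)
Lemma simple_orbit b : exists t i, b = act_word t (sg i).
Proof.
pose ht b := \sum_i scoord i b.
have ht_refl i c : ht (refl_root (sg i) c) = ht c - (cartan (sg i) c)%:~R.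
  rewrite /ht (eq_bigr _ (fun j _ => scoord_refl i j c)) sumrB; congr (_ - _).
  rewrite (bigD1 i) //= eqxx mulr1 big1 ?addr0 // => j /negPf ->.
  by rewrite mulr0.
have pos_orbit (m : nat) : forall c, positive c -> ht c < m%:R ->
    exists t i, c = act_word t (sg i).
  elim: m => [|m IH] c cp hc; first by move: hc; rewrite ltNge sumr_ge0.
  have [[i ->]|nc] := pselect (exists i, c = sg i); first by exists [::], i.
  have [i ci] := positive_descent cp.
  have dp : positive (refl_root (sg i) c).
    by apply: positive_refl => // e; apply: nc; exists i.
  have [|t [j e]] := IH _ dp.
    rewrite ht_refl ltrBlDr (lt_le_trans hc) // -natr1 lerD2l.
    by rewrite -[1]/(1%:~R) ler_int.
  by exists (i :: t), j; rewrite /= -e refl_rootK.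
have pos_orbit' c : positive c -> exists t i, c = act_word t (sg i).
  by move=> cp; apply: (pos_orbit (Num.bound (ht c))) => //; apply: archi_boundP; rewrite sumr_ge0.
have [/pos_orbit' //|/pos_orbit'[t [i e]]] := positive_or_opp b.
(* b = - t (sg i) = t (r_i (sg i)). *)
exists (rcons t i), i; rewrite -cats1 act_word_cat /= -/(opp_root (sg i)).
rewrite /opp_root act_word_refl -e.
by apply: root_eq; rewrite !opp_root_val opprK.
Qed.

(** Look at the moment when the root changes sign: by [positive_refl], it is then
    the simple root of the letter being applied. *)
Lemma act_word_split t c : positive c -> ~ positive (act_word t c) ->
  exists t1 i t2, t = t1 ++ i :: t2 /\ act_word t2 c = sg i.
Proof.
move=> cp; elim: t => [//|i t IH] /= neg.
have [tp|/IH[t1 [j [t2 [-> e]]]]] := pselect (positive (act_word t c)); last first.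
  by exists (i :: t1), j, t2.
exists [::], i, t; split=> //.
by apply: contrapT => /(positive_refl tp).
Qed.

Lemma opp_simple_not_positive i : ~ positive (opp_root (sg i)).
Proof. by move/(_ i); rewrite scoord_opp scoord_simple eqxx lerNr oppr0 ler10. Qed.

End Base.

(** * Congruence modulo a central subgroup *)
Section CentralCongruence.
Variables (U : groupType) (C : set U).
Hypothesis C_group : is_gsubgroup C.
Hypothesis C_central : forall c, C c -> forall u, commute c u.
Implicit Types u v : U.
Local Open Scope group_scope.

Definition cong u v : Prop := exists2 c, C c & u = c * v.

Lemma cong_refl u : cong u u.
Proof. by case: C_group => C1 _ _; exists 1; rewrite ?mul1g. Qed.
Lemma cong_sym u v : cong u v -> cong v u.
Proof. by case: C_group => _ _ CV [c Cc ->]; exists c^-1; [exact: CV|rewrite mulKg]. Qed.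
Lemma cong_trans v u w : cong u v -> cong v w -> cong u w.
Proof.
case: C_group => _ CM _ [c Cc ->] [d Cd ->]; exists (c * d); first exact: CM.
by rewrite mulgA.
Qed.
Lemma congM u u' v v' : cong u u' -> cong v v' -> cong (u * v) (u' * v').
Proof.
case: C_group => _ CM _ [c Cc ->] [d Cd ->]; exists (c * d); first exact: CM.
by rewrite -!mulgA; congr (_ * _); rewrite !mulgA (C_central Cd u').
Qed.
Lemma cong_comm u v : C (u * v * u^-1 * v^-1) -> cong (u * v) (v * u).
Proof. by move=> Cuv; exists (u * v * u^-1 * v^-1) => //; free_reduce. Qed.

Lemma congV u v : cong u v -> cong u^-1 v^-1.
Proof.
case: C_group => _ _ CV [c Cc ->]; exists c^-1; first exact: CV.
by rewrite invgM; apply/esym/commuteV/commute_sym/commuteV/commute_sym; apply: C_central.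
Qed.

Lemma cong_comm_span (A : set U) :
  (forall a b, A a -> A b -> cong (a * b) (b * a)) ->
  forall u v, gspan A u -> gspan A v -> cong (u * v) (v * u).
Proof.
move=> AA.
have half v : (forall a, A a -> cong (a * v) (v * a)) ->
    forall u, gspan A u -> cong (u * v) (v * u).
  move=> Av; apply: gspan_ind => [//||a b av bv|a av].
  - by rewrite mul1g mulg1; exact: cong_refl.
  - rewrite -mulgA; apply: (@cong_trans (a * (v * b))).
      exact: congM (cong_refl _) bv.
    by rewrite !mulgA; apply: congM av (cong_refl _).
  - have := congM (congM (cong_refl a^-1) av) (cong_refl a^-1).
    by free_reduce; exact: cong_sym.
move=> u v Au Av; apply: (half v _ u Au) => a Aa; apply: cong_sym.
by apply: (half a _ v Av) => b Ab; apply: AA.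
Qed.

Lemma cong_prodM (I : Type) (r : seq I) (a b : I -> U) :
  (forall i j, cong (a i * b j) (b j * a i)) ->
  cong (\prod_(i <- r) a i * \prod_(i <- r) b i) (\prod_(i <- r) (a i * b i)).
Proof.
move=> ab; elim: r => [|i r IH]; first by rewrite !big_nil mulg1; exact: cong_refl.
rewrite !big_cons; set A := \prod_(j <- r) a j; set B := \prod_(j <- r) b j.
have Ab : cong (A * b i) (b i * A).
  rewrite {}/A; elim: r {IH B} => [|j r IH].
    by rewrite big_nil mulg1 mul1g; exact: cong_refl.
  rewrite big_cons -mulgA; apply: (@cong_trans (a j * (b i * \prod_(k <- r) a k))).
    exact: congM (cong_refl _) IH.
  by rewrite !mulgA; apply: congM (ab j i) (cong_refl _).
have -> : a i * A * (b i * B) = a i * (A * b i) * B by rewrite !mulgA.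
apply: (@cong_trans (a i * (b i * A) * B)).
  exact: congM (congM (cong_refl _) Ab) (cong_refl _).
by rewrite -(mulgA (a i)) -!(mulgA (b i)) mulgA; exact: congM (cong_refl _) IH.
Qed.

Lemma cong_prod (I : Type) (r : seq I) (a b : I -> U) :
  (forall i, cong (a i) (b i)) -> cong (\prod_(i <- r) a i) (\prod_(i <- r) b i).
Proof.
move=> ab; elim: r => [|i r IH]; first by rewrite !big_nil; exact: cong_refl.
by rewrite !big_cons; exact: congM (ab i) IH.
Qed.
End CentralCongruence.

(** * Defects are central; normal form of an element *)
Section NormalForm.
Variables (R : realType) (n : nat) (D : rootSystem R n) (G : zmodType).
Variables (Rx : extRootSystem D G) (U : reflGroup (refl_system Rx)).
Variables (l : nat) (s : l.-tuple (Defs.root D)).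
Hypothesis base : is_base s.
Implicit Types (a b c : Defs.root D) (g h k : G) (t : seq 'I_l) (u v : U).
Local Notation sg := (tnth s).
Local Notation w := (wgen U).
Local Notation x := (xgen U).
Local Notation F a := (defect (x a)).
Local Notation slice := (slice Rx).
Local Open Scope group_scope.

Fixpoint word_elt t : U := if t is i :: t' then w (sg i) * word_elt t' else 1.

Lemma word_elt_cat t t' : word_elt (t ++ t') = word_elt t * word_elt t'.
Proof. by elim: t => [|i t IH] /=; rewrite ?mul1g // IH mulgA. Qed.

Lemma word_eltV t : (word_elt t)^-1 = word_elt (rev t).
Proof.
elim: t => [|i t IH] /=; first exact: invg1.
by rewrite invgM IH wgenV rev_cons -cats1 word_elt_cat /= mulg1.
Qed.

Lemma slice_word t b : slice (act_word s t b) = slice b.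
Proof. by elim: t => //= i t IH; rewrite slice_reflE. Qed.

Lemma rgen_word t g b : slice b g ->
  word_elt t * rgen U g b * (word_elt t)^-1 = rgen U g (act_word s t b).
Proof.
move=> Sg; elim: t => [|i t IH] /=; first by free_reduce.
rewrite -wgenJr -?IH; first by free_reduce.
by rewrite slice_word.
Qed.

Lemma wgen_word t b : word_elt t * w b * (word_elt t)^-1 = w (act_word s t b).
Proof. exact/rgen_word/slice0. Qed.

Lemma xgen_word t b g : slice b g ->
  word_elt t * x b g * (word_elt t)^-1 = x (act_word s t b) g.
Proof. by move=> Sg; rewrite /xgen -rgen_word // -wgen_word; free_reduce. Qed.

(** The Weyl group of D has the presentation by conjugation.  Exchange argument: if
    the nonempty word t k acts trivially, then t makes [sg k] negative, so t = t1 i t2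
    where t2 sends [sg k] to [sg i]; the conjugation relation cancels the letters i and k,
    and the shorter word t1 t2 still acts trivially. *)
Lemma word_elt_faithful t : (forall b, act_word s t b = b) -> word_elt t = 1.
Proof.
have [m] := ubnP (size t); elim: m t => // m IH t; case/lastP: t => // t k.
rewrite size_rcons ltnS -cats1 => tm fixt.
have act b : act_word s t (refl_root (sg k) b) = b by rewrite -[RHS]fixt act_word_cat.
have neg : ~ positive s (act_word s t (sg k)).
  have -> : act_word s t (sg k) = opp_root (sg k).
    by rewrite -[in LHS](refl_rootK (sg k) (sg k)); exact: act.
  exact: opp_simple_not_positive.
have [t1 [i [t2 [te e]]]] := act_word_split base (positive_simple base k) neg.
have we : word_elt t2 * w (sg k) = w (sg i) * word_elt t2.
  by rewrite -e -wgen_word; free_reduce.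
have -> : word_elt (t ++ [:: k]) = word_elt (t1 ++ t2).
  rewrite te !word_elt_cat /= mulg1 -!mulgA we (mulgA (w _)) wgen2 mul1g.
  by [].
apply: IH => [|b].
  by move: tm; rewrite te !size_cat /= addnS => /ltnW.
rewrite -[RHS](act b) te !act_word_cat /= (act_word_refl s t2) e.
by rewrite refl_rootK.
Qed.

Definition trans_gens : set U :=
  [set u | exists i g, slice (sg i) g /\ u = x (sg i) g].
Definition translations : set U := gspan trans_gens.

Lemma translations_group : is_gsubgroup translations.
Proof. exact: gspan_sub. Qed.

(** From [xgen_rel] at h = 0: x_{r_c a}(g) is a product of values of x_a and x_c. *)
Lemma translations_simple i b g : slice b g -> translations (x b g) ->
  translations (x (refl_root (sg i) b) g).
Proof.
case: translations_group => _ TM TV Sg Tg.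
have := xgen_rel U (sliceN Sg) (slice0 Rx (sg i)); rewrite add0r xgen0 mulg1 opprK.
rewrite xgenV // => e.
have -> : x (refl_root (sg i) b) g = x b g * x (sg i) (- g *~ cartan b (sg i))%R.
  by rewrite -e; free_reduce.
apply: TM => //; apply: gspan_gen; exists i, (- g *~ cartan b (sg i))%R; split=> //.
have := slice_shift Sg (slice0 Rx (sg i)).
by rewrite add0r mulNrz.
Qed.

Lemma translations_xgen b g : slice b g -> translations (x b g).
Proof.
have [t [i ->]] := simple_orbit base b; rewrite slice_word => Sg.
elim: t => [|j t IH] /=; last by apply: translations_simple => //; rewrite slice_word.
by apply: gspan_gen; exists i, g.
Qed.

Lemma translations_word t u : translations u ->
  translations (word_elt t * u * (word_elt t)^-1).
Proof.
case: translations_group => T1 TM TV.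
pose P : set U := [set v | translations (word_elt t * v * (word_elt t)^-1)].
apply: (gspan_ind (P := P)) => [_ [i [g [Sg ->]]]||v v' Tv Tv'|v Tv]; rewrite /P /=.
- by rewrite xgen_word //; apply: translations_xgen; rewrite slice_word.
- by rewrite mulg1 mulgV.
- have := TM _ _ Tv Tv'; rewrite /P /=; free_reduce; exact.
- have := TV _ Tv; rewrite /P /=; free_reduce; exact.
Qed.

(** U is a product of the normalised subgroup of translations and the words. *)
Lemma translations_words u : exists v t, translations v /\ u = v * word_elt t.
Proof.
case: translations_group => T1 TM TV.
pose P : set U := [set u | exists v t, translations v /\ u = v * word_elt t].
suff : P u by [].
have : gspan (range (rg_gen U)) u by rewrite (rg_G1 (rg_prop U)).
apply: (gspan_ind (P := P)) => [_ [r _ <-]||v v'|v].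
- have [g [a [Sg ->]]] := rg_gen_rgen U r.
  have [t [i ae]] := simple_orbit base a.
  exists (x a g), (t ++ i :: rev t); split; first exact: translations_xgen.
  rewrite word_elt_cat /= -word_eltV.
  have -> : word_elt t * (w (sg i) * (word_elt t)^-1) = w a by rewrite mulgA wgen_word -ae.
  by rewrite /xgen -mulgA wgen2 mulg1.
- by exists 1, [::]; rewrite mulg1.
- move=> [m [t [Tm ->]]] [m' [t' [Tm' ->]]].
  exists (m * (word_elt t * m' * (word_elt t)^-1)), (t ++ t'); split.
    by apply: TM => //; apply: translations_word.
  by rewrite word_elt_cat; free_reduce.
- move=> [m [t [Tm ->]]]; exists (word_elt (rev t) * m^-1 * (word_elt (rev t))^-1), (rev t).
  split; first by apply: translations_word; apply: TV.
  by rewrite -word_eltV; free_reduce.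
Qed.

Hypothesis simple_neighbour : forall i, exists b, adjacent (sg i) b.
Hypothesis simple_link : forall i j, linked (sg i) (sg j).

Lemma defect_refl a b d g h : adjacent a b -> slice a g -> slice a h ->
  w d * F a g h * (w d)^-1 = F (refl_root d a) g h.
Proof.
move=> adj Sg Sh; have [_ SB] := slice_subgroup Rx adj.
by rewrite /defect -(xgenJ _ _ (SB _ _ Sh Sg)) -(xgenJ _ _ Sg) -(xgenJ _ _ (sliceN Sh)); free_reduce.
Qed.

(** The translations of - a at g are those of a at - g, and the defect is even. *)
Lemma defect_opp a b g h : adjacent a b -> slice a g -> slice a h ->
  F (opp_root a) g h = F a g h.
Proof.
move=> adj Sg Sh; have [_ SB] := slice_subgroup Rx adj.
have xo k : slice a k -> x (opp_root a) k = x a (- k)%R.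
  by move=> Sk; rewrite -(xgenN_opp U (sliceN Sk)) opprK.
have Shg := SB _ _ Sh Sg; have SNh := sliceN Sh.
by rewrite -(defectNN U adj Sg Sh) /defect !xo // opprD.
Qed.

Lemma defect_commute a b h k u : adjacent a b -> slice a h -> slice a k ->
  (forall g, slice a g -> commute (x a g) u) -> commute (F a h k) u.
Proof.
move=> adj Sh Sk xu; have [_ SB] := slice_subgroup Rx adj.
apply: commute_sym; rewrite /defect.
apply: commuteM; [apply: commuteM|]; apply: commute_sym; apply: xu => //.
  exact: SB.
exact: sliceN.
Qed.

Lemma commute_conj u v : v * u * v^-1 = u -> commute u v.
Proof. by move=> e; rewrite /commute -{1}e; free_reduce. Qed.

(** Replace [sg i] by the linked root d, whose defect is the same.  If d = [sg j], the
    hexagon lemmas apply; if d is orthogonal to [sg j], the factors of the defect already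
    commute with everything attached to [sg j]. *)
Lemma simple_defect_commute i j g h : slice (sg i) g -> slice (sg i) h ->
  (forall k, slice (sg j) k -> commute (F (sg i) g h) (x (sg j) k)) /\
    commute (F (sg i) g h) (w (sg j)).
Proof.
move=> Sg Sh; have [d [di dj]] := simple_link i j.
have [e adj] : exists e, adjacent d e.
  by case: di => [->|[? ?]]; [exact: simple_neighbour|exists (sg i)].
have [Fe Se] : F (sg i) g h = F d g h /\ slice d = slice (sg i).
  case: di => [->//|adj']; split; first exact: adjacent_defect.
  exact/esym/slice_adjacent.
rewrite Fe; rewrite -Se in Sg Sh; case: dj => [<-|dj].
  split=> [k Sk|]; first by have [] := adjacent_commute U adj Sg Sh Sk.
  apply: commute_conj; rewrite -[RHS](defect_opp adj) //.
  exact: defect_refl adj Sg Sh.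
split=> [k Sk|]; apply: (defect_commute adj) => // p Sp; first exact: xgen_orth.
apply: commute_conj; rewrite xgenJ //; congr x.
by apply: root_eq; rewrite refl_root_val (cartan_eq0 dj) scale0r subr0.
Qed.

Lemma simple_defect_central i g h u : slice (sg i) g -> slice (sg i) h ->
  commute (F (sg i) g h) u.
Proof.
move=> Sg Sh; have [v [t [Tv ->]]] := translations_words u.
apply: commuteM.
  pose P : set U := [set v | commute (F (sg i) g h) v].
  move: v Tv; apply: (gspan_ind (P := P)) => [_ [j [k [Sk ->]]]||v v'|v].
  - by have [+ _] := simple_defect_commute j Sg Sh; apply.
  - exact: commute1.
  - exact: commuteM.
  - exact: commuteV.
elim: t => [|j t IH] /=; first exact: commute1.
by apply: commuteM => //; have [] := simple_defect_commute j Sg Sh.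
Qed.

Definition simple_defects : set U :=
  [set u | exists i g h, [/\ slice (sg i) g, slice (sg i) h & u = F (sg i) g h]].
Definition defect_group : set U := gspan simple_defects.

Lemma defect_group_group : is_gsubgroup defect_group.
Proof. exact: gspan_sub. Qed.

Lemma defect_group_central (z : U) : defect_group z -> forall u, commute z u.
Proof.
pose P : set U := [set z | forall u, commute z u].
apply: (gspan_ind (P := P)) => [_ [i [g [h [Sg Sh ->]]]] u|u|v v' cv cv' u|v cv u].
- exact: simple_defect_central.
- exact/commute_sym/commute1.
- by apply: commute_sym; apply: commuteM; apply: commute_sym.
- by apply: commute_sym; apply: commuteV; apply: commute_sym.
Qed.
Local Notation "u ~~ v" := (cong defect_group u v) (at level 70).

Lemma translations_comm u v : translations u -> translations v -> u * v ~~ v * u.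
Proof.
apply: (cong_comm_span defect_group_group defect_group_central).
move=> _ _ [i [g [Sg ->]]] [j [h [Sh ->]]]; apply: cong_comm.
rewrite xgen_comm //; apply: gspan_gen; exists j, (- g *~ cartan (sg i) (sg j))%R, h.
split=> //; have := slice_shift Sg (slice0 Rx (sg j)); by rewrite add0r mulNrz.
Qed.

Definition normal_form (gam : 'I_l -> G) : U := \prod_(i < l) x (sg i) (gam i).
Definition slice_family (gam : 'I_l -> G) : Prop := forall i, slice (sg i) (gam i).

Lemma translations_simple_xgen i g : slice (sg i) g -> translations (x (sg i) g).
Proof. by move=> Sg; apply: gspan_gen; exists i, g. Qed.

(** Modulo defects, translations commute and each x_i is additive. *)
Lemma normal_formM gam del : slice_family gam -> slice_family del ->
  normal_form gam * normal_form del ~~ normal_form (fun i => gam i + del i)%R.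
Proof.
move=> Sg Sd; apply: (cong_trans defect_group_group).
  apply: (cong_prodM defect_group_group defect_group_central) => i j.
  by apply: translations_comm; apply: translations_simple_xgen.
apply: (cong_prod defect_group_group defect_group_central) => i.
have [b adj] := simple_neighbour i.
rewrite (xgen_mul U adj) //; exists (F (sg i) (del i) (gam i)) => //.
by apply: gspan_gen; exists i, (del i), (gam i).
Qed.

Lemma normal_form_single i g : slice (sg i) g ->
  x (sg i) g = normal_form (fun j => if j == i then g else 0%R).
Proof.
move=> Sg; rewrite /normal_form.
rewrite (eq_bigr (fun j => if j == i then x (sg j) g else 1)); last first.
  by move=> j _; case: eqP => // _; rewrite xgen0.
by rewrite -big_mkcond big_pred1_eq.
Qed.

Lemma normal_formP u : translations u ->
  exists gam, slice_family gam /\ u ~~ normal_form gam.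
Proof.
have cgg := defect_group_group; have cgc := defect_group_central.
pose P : set U := [set u | exists gam, slice_family gam /\ u ~~ normal_form gam].
have nf0 : normal_form (fun=> 0%R) = 1.
  by rewrite /normal_form big1 // => i _; exact: xgen0.
apply: (gspan_ind (P := P)) => [_ [i [g [Sg ->]]]||u1 u2|u1]; rewrite /P /mkset.
- exists (fun j => if j == i then g else 0%R); split.
    by move=> j; case: eqP => [->|_] //; exact: slice0.
  by rewrite -normal_form_single //; exact: cong_refl.
- exists (fun=> 0%R); split; first by move=> i; exact: slice0.
  by rewrite nf0; exact: cong_refl.
- move=> [g1 [S1 e1]] [g2 [S2 e2]]; exists (fun i => g1 i + g2 i)%R; split.
    move=> i; have [b adj] := simple_neighbour i.
    have [_ SB] := slice_subgroup Rx adj.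
    by rewrite -[g2 i]opprK; apply: SB => //; exact: sliceN.
  by apply: (cong_trans cgg (congM cgg cgc e1 e2)); exact: normal_formM.
- move=> [g1 [S1 e1]]; have S2 : slice_family (fun i => - g1 i)%R.
    by move=> i; exact: sliceN.
  exists (fun i => - g1 i)%R; split=> //.
  apply: (cong_trans cgg (congV cgg cgc e1)).
  have := normal_formM S1 S2.
  have -> : (fun i => g1 i + - g1 i)%R = (fun=> 0%R) :> ('I_l -> G).
    by apply/funext => i; rewrite subrr.
  rewrite nf0 => /(congM cgg cgc (cong_refl cgg (normal_form g1)^-1)).
  by free_reduce; exact: cong_sym.
Qed.

Lemma decomposition u : exists (z : U) gam t,
  [/\ defect_group z, slice_family gam & u = z * normal_form gam * word_elt t].
Proof.
have [v [t [/normal_formP[gam [Sgam [z Cz ->]]] ->]]] := translations_words u.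
by exists z, gam, t.
Qed.
End NormalForm.

(** * Admissible forms from pairs of additive functionals *)
Section Form.
Variables (R : realType) (n : nat) (D : rootSystem R n) (G : zmodType).
Variable (Rx : extRootSystem D G).
Implicit Types (a b c : Defs.root D).
Local Notation K := (Kgroup Rx).
Local Notation E := 'rV[R]_n.
Implicit Types k : K.

Lemma dot_roots_inj (u v : E) :
  (forall b : Defs.root D, dot u (root_val b) = dot v (root_val b)) -> u = v.
Proof.
move=> uv; apply/eqP; rewrite -subr_eq0 -dot_eq0; set y := u - v.
have y0 b : dot y (root_val b) = 0 by rewrite dotBl uv subrr.
have yin : y \in <<in_tuple (enum_fset (Defs.roots D))>>%VS by rewrite root_span memvf.
rewrite {2}(coord_span yin) (big_morph (dot y) (id1 := 0) (op1 := +%R)).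
- rewrite big1 // => i _; rewrite dotZr.
  have bi : (in_tuple (enum_fset (Defs.roots D)))`_i \in Defs.roots D by rewrite mem_nth.
  by rewrite (y0 [` bi]%fset) mulr0.
- by move=> p q; rewrite dotDr.
- exact: dot0r.
Qed.

Lemma coroot_refl a c : coroot (root_val (refl_root c a)) =
  reflection (root_val c) (coroot (root_val a)).
Proof.
rewrite /coroot -[root_val (refl_root c a)]/(reflection (root_val c) (root_val a)).
by rewrite dot_reflection /reflection dotZr scalerBr scalerA.
Qed.

Lemma dot_coroot_refl a c :
  dot (coroot (root_val c)) (coroot (root_val (refl_root c a))) =
  - dot (coroot (root_val c)) (coroot (root_val a)).
Proof.
rewrite coroot_refl /reflection dotBr dotZr.
rewrite -(cartanE c c) cartan_self; ring.
Qed.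

Lemma refl_lat_mul a c :
  (refl_lat a * refl_lat c)%g = (refl_lat (refl_root a c) * refl_lat a)%g.
Proof.
apply: autP => m; rewrite autME [RHS]autME -[RHS]refl_lat_conj.
by congr (refl_lat a (refl_lat c _)); rewrite [RHS]refl_latK.
Qed.

Section Vec.
Variable phi : {additive G -> R}.

(** K consists of homomorphisms from the root lattice to G; composed with [phi] they
    become real functionals, represented by vectors of the Euclidean space. *)
Lemma vec_exists k : exists v : E,
  forall l : root_lattice D, dot v (lat_val l) = phi (Kval k l).
Proof.
have := set_mem (valP k); rewrite -/(Kval k).
pose P : set (root_lattice D -> G) :=
  [set f | exists v : E, forall l, dot v (lat_val l) = phi (f l)].
apply: (zspan_ind (P := P)) => [_ [[g a] _ <-]||f f' [v vE] [v' vE']].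
- exists (phi g *: coroot (root_val a)) => l.
  by rewrite dotZl /tensor raddfMz -pairingE mulrzr.
- by exists 0 => l; rewrite dotC dot0r raddf0.
- by exists (v - v') => l; rewrite dotBl vE vE' -raddfB.
Qed.

Definition vec k : E := projT1 (cid (vec_exists k)).

Lemma vecE k l : dot (vec k) (lat_val l) = phi (Kval k l).
Proof. by rewrite /vec; case: cid. Qed.

Lemma vec_uniq k v : (forall l, dot v (lat_val l) = phi (Kval k l)) -> vec k = v.
Proof.
move=> vl; apply: dot_roots_inj => b.
by rewrite -[root_val b]/(lat_val (root_lat b)) vecE vl.
Qed.

Lemma vecD k k' : vec (k + k') = vec k + vec k'.
Proof. by apply: vec_uniq => l; rewrite dotDl !vecE KvalD raddfD. Qed.

Lemma vec_tensor k g a : Kval k = tensor g a -> vec k = phi g *: coroot (root_val a).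
Proof.
move=> kE; apply: vec_uniq => l.
by rewrite dotZl kE /tensor raddfMz -pairingE mulrzr.
Qed.
End Vec.

(** Elements of the Weyl group are given as automorphisms of the lattice; the
    induction on their generation recovers the underlying isometries, whose
    action on [vec] is compared in [vec_isometry]. *)
Lemma weyl_isometry (v : weyl_group D) : exists f : E -> E,
  (forall x y, dot (f x) (f y) = dot x y) /\
  (forall x l, dot (f x) (lat_val (val v l)) = dot x (lat_val l)).
Proof.
pose P : set (aut (root_lattice D)) := [set w | exists f : E -> E,
  (forall x y, dot (f x) (f y) = dot x y) /\
  (forall x l, dot (f x) (lat_val (w l)) = dot x (lat_val l))].
pose Q : set (aut (root_lattice D)) := [set w | P w /\ P w^-1%g].
have PM w w' : P w -> P w' -> P (w * w')%g.
  move=> [f [ff fw]] [f' [ff' fw']]; exists (f \o f'); split=> [x y|x l] /=.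
    by rewrite ff ff'.
  by rewrite fw fw'.
suff [] : Q (val v) by [].
apply: (gspan_ind (P := Q)) (set_mem (valP v)) => [_ [a _ <-]||x y|x].
- have Pa : P (refl_lat a).
    exists (reflection (root_val a)); split=> [x y|x l]; first exact: dot_reflection.
    by rewrite refl_lat_val dot_reflection.
  by split.
- by split; exists id; split.
- by move=> [Px Px'] [Py Py']; split; rewrite ?invgM; apply: PM.
- by move=> [Px Px']; split; rewrite ?invgK.
Qed.

Lemma vec_isometry (v : weyl_group D) : exists f : E -> E,
  (forall x y, dot (f x) (f y) = dot x y) /\
  forall (phi : {additive G -> R}) k, vec phi (actK v k) = f (vec phi k).
Proof.
have [f [ff fv]] := weyl_isometry v; exists f; split=> // phi k.
apply: vec_uniq => l; by rewrite actKE -vecE -[RHS]fv autVE aut_invK.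
Qed.

(** A constructor with a declared type, so that products of triples are taken in
    the semidirect product. *)
Definition triple (Z : zmodType) (b : invariantBihom Rx Z) (z : Z) (k : K)
  (v : weyl_group D) : sdprod (actKb b) := ((z, k), v).

Lemma tripleM (Z : zmodType) (b : invariantBihom Rx Z) z k v z' k' v' :
  (triple b z k v * triple b z' k' v')%g =
  triple b (z + z' + b k (actK v k')) (k + actK v k') (v * v')%g.
Proof. by []. Qed.

Lemma refl_tripleE (Z : zmodType) (b : invariantBihom Rx Z) t :
  refl_triple b t = triple b 0 (reflK t) (reflV t).
Proof. by []. Qed.

Section WedgeForm.
Variables phi psi : {additive G -> R}.

Definition wedge (g h : G) : R := phi g * psi h - psi g * phi h.

Lemma wedge_shift g h (m : int) : wedge (h - g *~ m) g = - wedge g h.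
Proof.
have e (f : {additive G -> R}) : f (h - g *~ m) = f h - f g * m%:~R.
  by rewrite raddfB raddfMz mulrzr.
by rewrite /wedge !e; ring.
Qed.

Definition wedge_fun k k' : R :=
  dot (vec phi k) (vec psi k') - dot (vec psi k) (vec phi k').

Fact wedge_funDl x y z : wedge_fun (x + y) z = wedge_fun x z + wedge_fun y z.
Proof. by rewrite /wedge_fun !vecD !dotDl opprD addrACA. Qed.
Fact wedge_funDr x y z : wedge_fun x (y + z) = wedge_fun x y + wedge_fun x z.
Proof. by rewrite /wedge_fun !vecD !dotDr opprD addrACA. Qed.
Fact wedge_fun_alt x : wedge_fun x x = 0.
Proof. by rewrite /wedge_fun dotC subrr. Qed.
Fact wedge_fun_inv v x y : wedge_fun (actK v x) (actK v y) = wedge_fun x y.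
Proof.
have [f [ff fv]] := vec_isometry v.
by rewrite /wedge_fun !fv !ff.
Qed.

Definition wedge_bihom : invariantBihom Rx R :=
  InvariantBihom wedge_funDl wedge_funDr wedge_fun_alt wedge_fun_inv.

Lemma wedge_bihomE k k' g h a b : Kval k = tensor g a -> Kval k' = tensor h b ->
  wedge_bihom k k' = dot (coroot (root_val a)) (coroot (root_val b)) * wedge g h.
Proof.
move=> kE kE'; rewrite /= /wedge_fun (vec_tensor phi kE) (vec_tensor psi kE').
rewrite (vec_tensor psi kE) (vec_tensor phi kE') !(dotZl, dotZr) /wedge; ring.
Qed.

Local Notation T := (refl_system Rx).
Local Notation b := wedge_bihom.

Lemma refl_repr_root (t : T) : exists g a, ers Rx (g, a) /\
  [/\ sval t = ext_refl (g, a), Kval (reflK t) = tensor g a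
    & val (reflV t) = refl_lat a].
Proof.
have [[g a] Ra e] := svalP t; exists g, a; split=> //; split=> //.
  exact: reflKE e.
exact: reflVE e.
Qed.

(** With d = r_a c, comparison of the central components amounts to
    (a^v, d^v) (g /\ h) = (d^v, (r_d a)^v) ((h - p g) /\ g), which holds because r_d
    reverses d^v and the wedge is alternating. *)
Lemma refl_triple_conj (t s : T) :
  (refl_triple b t * refl_triple b s = refl_triple b (sym_op t s) * refl_triple b t)%g.
Proof.
have [g [a [_ [te tK tV]]]] := refl_repr_root t.
have [h [c [_ [se sK sV]]]] := refl_repr_root s.
have tse : sval (sym_op t s) = ext_refl (ext_refl_root (g, a) (h, c)).
  by rewrite /= te se; exact: ext_refl_conj.
set d := refl_root a c in tse *; set p := pairing a (root_lat c) in tse *.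
have tsK : Kval (reflK (sym_op t s)) = tensor (h - g *~ p) d := reflKE tse.
have tsV : val (reflV (sym_op t s)) = refl_lat d := reflVE tse.
have actE (v : weyl_group D) k r e q : val v = refl_lat r -> Kval k = tensor q e ->
    Kval (actK v k) = tensor q (refl_root r e).
  move=> vp; have -> : v = weyl_refl r by exact: val_inj.
  exact: actK_tensor.
have tsK' := actE _ _ _ _ _ tV sK.
have stK' := actE _ _ _ _ _ tsV tK.
have pd : cartan a d = - p by exact: cartan_reflr.
have e1 : b (reflK t) (actK (reflV t) (reflK s)) =
    b (reflK (sym_op t s)) (actK (reflV (sym_op t s)) (reflK t)).
  rewrite (wedge_bihomE tK tsK') (wedge_bihomE tsK stK').
  by rewrite wedge_shift (dot_coroot_refl a d) (dotC (coroot (root_val d))) mulrNN.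
have e2 : reflK t + actK (reflV t) (reflK s) =
    reflK (sym_op t s) + actK (reflV (sym_op t s)) (reflK t).
  apply: Kval_inj; apply/funext => l; rewrite !KvalD tK tsK tsK' stK' /tensor.
  rewrite (pairing_refl_l d a) pd mulNr opprK mulrzBl mulrzDr mulrzA.
  by rewrite [RHS]addrACA addNr addr0 addrC.
have e3 : (reflV t * reflV s)%g = (reflV (sym_op t s) * reflV t)%g.
  by apply: val_inj; rewrite [LHS]valM [RHS]valM tV sV tsV refl_lat_mul.
by rewrite !refl_tripleE !tripleM e1 e2 e3.
Qed.

Lemma act_refl_self (t : T) : actK (reflV t) (reflK t) = - reflK t.
Proof.
have [g [a [_ [te tK tV]]]] := refl_repr_root t.
apply: Kval_inj; apply/funext => l.
have -> : reflV t = weyl_refl a by exact: val_inj.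
rewrite (actK_tensor a tK) -[- reflK t]sub0r KvalB tK /tensor.
by rewrite pairing_refl_l -/(cartan a a) cartan_self mulrDl mul1r opprD addrA subrr add0r mulrNz sub0r.
Qed.

Lemma reflV2 (t : T) : (reflV t * reflV t)%g = 1%g.
Proof.
have [g [a [_ [_ _ tV]]]] := refl_repr_root t.
apply: val_inj; rewrite [LHS]valM tV; apply: autP => m.
by rewrite autME; exact: refl_latK.
Qed.

Lemma refl_triple2 (t : T) : (refl_triple b t * refl_triple b t)%g = 1%g.
Proof.
by rewrite !refl_tripleE tripleM act_refl_self bihNr bih_alt reflV2 subrr oppr0 !addr0.
Qed.

Lemma Ab_gen_spans : gspan (range (Ab_gen b)) = setT.
Proof.
apply/seteqP; split=> // z _.
have [S1 SM SV] := gspan_sub (range (Ab_gen b)).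
pose P : set (sdprod (actKb b)) :=
  [set y | exists2 z', gspan (range (Ab_gen b)) z' & val z' = y].
have : P (val z).
  apply: (gspan_ind (P := P)) (set_mem (valP z)) => [_ [t _ <-]||x y|x].
  - by exists (Ab_gen b t) => //; apply: gspan_gen; exists t.
  - by exists 1%g.
  - by move=> [x' Sx <-] [y' Sy <-]; exists (x' * y')%g; [exact: SM|exact: valM].
  - by move=> [x' Sx <-]; exists (x'^-1)%g; [exact: SV|].
by case=> z' Sz' /val_inj <-.
Qed.

Lemma wedge_is_reflection_bihom : is_reflection_bihom b.
Proof.
have projE t : Ab_proj (refl_triple b t) = sval t by exact: affine_refl.
split.
- move=> t; apply: refl_sortP.
  change (Ab_proj (1 : sdprod (actKb b)) * sval t *
    (Ab_proj (1 : sdprod (actKb b)))^-1 = sval t)%g.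
  by rewrite Ab_proj1 invg1 mul1g mulg1.
- move=> x y t; apply: refl_sortP.
  change (Ab_proj (val x * val y) * sval t * (Ab_proj (val x * val y))^-1 =
    Ab_proj (val x) * (Ab_proj (val y) * sval t * (Ab_proj (val y))^-1) *
    (Ab_proj (val x))^-1)%g.
  by rewrite Ab_projM; free_reduce.
- exact: Ab_gen_spans.
- move=> t s; apply: refl_sortP.
  change (Ab_proj (refl_triple b t) * sval s * (Ab_proj (refl_triple b t))^-1 =
    sval t * sval s * (sval t)^-1)%g.
  by rewrite projE.
- move=> t s; apply: val_inj.
  change (refl_triple b t * refl_triple b s * (refl_triple b t)^-1 =
    refl_triple b (sym_op t s))%g.
  by rewrite refl_triple_conj mulgK.
- by move=> t; apply: val_inj; exact: refl_triple2.
Qed.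

(** By hypothesis 2 a is a multiple of c, and D is reduced. *)
Lemma root_double a c (m : R) : - root_val a = root_val a - m *: root_val c ->
  root_val a = root_val c \/ root_val a = - root_val c.
Proof.
move=> e; have ea : root_val a = (m / 2) *: root_val c.
  apply: (@scalerI _ _ (2 : R)); first by rewrite pnatr_eq0.
  rewrite scalerA mulrCA divff ?pnatr_eq0 // mulr1.
  have -> : (2 : R) = 1 + 1 by [].
  rewrite scalerDl scale1r -[X in _ + X]opprK e opprB addrC.
  by rewrite subrK.
have := root_mem a; rewrite ea => /(root_reduced (root_mem c)) [] ->.
  by left; rewrite scale1r.
by right; rewrite scaleN1r.
Qed.

Lemma refl_lat_eq a c : refl_lat a = refl_lat c ->
  root_val a = root_val c \/ root_val a = - root_val c.
Proof.
move=> ac; have : lat_val (refl_lat a (root_lat a)) = lat_val (refl_lat c (root_lat a)).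
  by rewrite ac.
rewrite -!root_lat_refl -[lat_val _]/(root_val (opp_root a)) opp_root_val.
rewrite -[RHS]/(root_val (refl_root c a)) refl_root_val.
set m : R := _%:~R => e.
have [-> | ->] := root_double (e : - root_val a = root_val a - m *: root_val c).
  by left.
by right.
Qed.

(** If the reflections commute, then r_a c = c or r_a c = - c; the latter makes c a
    multiple of a. *)
Lemma commuting_reflections a c : refl_lat a <> refl_lat c ->
  (refl_lat a * refl_lat c = refl_lat c * refl_lat a)%g -> cartan a c = 0.
Proof.
move=> ac comm.
have : refl_lat (refl_root a c) = refl_lat c.
  have := refl_lat_mul a c; rewrite comm => /mulIg ->; done.
case/refl_lat_eq; rewrite refl_root_val => e.
  apply/eqP; rewrite -(intr_eq0 R); have /eqP : (cartan a c)%:~R *: root_val a = 0.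
    by apply/eqP; rewrite -oppr_eq0 -(inj_eq (addrI (root_val c))) addr0; apply/eqP.
  rewrite scaler_eq0 => /orP[//|/eqP a0].
  by have := root_normN0 a; rewrite a0 dot0r eqxx.
case: ac; have [ca|ca] := root_double (esym e).
  by congr refl_lat; apply: root_eq.
have -> : c = opp_root a by apply: root_eq; rewrite opp_root_val.
by have := refl_lat_mul a a; move/mulIg.
Qed.

(** Roots with distinct commuting reflections are orthogonal, and then the scalar
    factor (a^v, c^v) of the form vanishes. *)
Lemma wedge_admissible : is_admissible b.
Proof.
split; first exact: wedge_is_reflection_bihom.
move=> s t st comm.
have [g [a [_ [_ sK sV]]]] := refl_repr_root s.
have [h [c [_ [_ tK tV]]]] := refl_repr_root t.
rewrite (wedge_bihomE sK tK).
suff ac : cartan a c = 0.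
  by rewrite [coroot (root_val c)]/coroot dotZr -cartanE ac mulr0 mul0r.
apply: commuting_reflections => [ac|].
  by apply: st; apply: val_inj; rewrite sV tV.
by have := congr1 val comm; rewrite [LHS]valM [RHS]valM sV tV.
Qed.
End WedgeForm.
End Form.

(** * Homomorphisms that vanish on the kernel *)
Section Detection.
Variables (R : realType) (n : nat) (D : rootSystem R n) (G : zmodType).
Variable (Rx : extRootSystem D G).
Variables (U : reflGroup (refl_system Rx)) (Z : zmodType) (w : invariantBihom Rx Z).
Variables (hw : is_universal_admissible w) (f : U -> ext_weyl_group hw).
Hypothesis fP : is_refl_morphism f.
Variables phi psi : {additive G -> R}.
Local Notation b := (wedge_bihom Rx phi psi).
Local Notation X := (xgen U).

(** The form factors through the universal one as q o w, and q acts on the central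
    component. *)
Lemma detection : exists F : U -> sdprod (actKb b),
  [/\ {morph F : u v / (u * v)%g}, forall t, F (rg_gen U t) = refl_triple b t
    & forall u, f u = 1%g -> F u = 1%g].
Proof.
have [q [[qB qE] _]] := hw.2 _ b (wedge_admissible Rx phi psi).
have q0 : q 0 = 0 by rewrite -(subrr 0) qB subrr.
have qD x y : q (x + y) = q x + q y.
  by rewrite -[y in LHS]opprK qB -[- y]sub0r qB q0 sub0r opprK.
pose F (u : U) : sdprod (actKb b) :=
  triple b (q (val (f u)).1.1) (val (f u)).1.2 (val (f u)).2.
exists F; split=> [u v|t|u fu].
- rewrite /F fP.1 tripleM.
  have -> : val (f u * f v)%g = (triple w (val (f u)).1.1 (val (f u)).1.2 (val (f u)).2 *
     triple w (val (f v)).1.1 (val (f v)).1.2 (val (f v)).2)%g.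
    by rewrite valM; case: (val (f u)) => -[? ?] ?; case: (val (f v)) => -[? ?] ?.
  by rewrite tripleM qE -!qD.
- by rewrite /F fP.2 refl_tripleE /= q0.
- by rewrite /F fu /= q0.
Qed.
End Detection.

Section Image.
Variables (R : realType) (n : nat) (D : rootSystem R n) (G : zmodType).
Variable (Rx : extRootSystem D G).
Variables (U : reflGroup (refl_system Rx)) (phi psi : {additive G -> R}).
Variables (l : nat) (s : l.-tuple (Defs.root D)).
Hypothesis base : is_base s.
Implicit Types (a c : Defs.root D) (g h : G) (u v : U).
Local Notation b := (wedge_bihom Rx phi psi).
Local Notation sg := (tnth s).
Local Notation x := (xgen U).
Local Notation slice := (slice Rx).
Local Notation tr := (triple b).

Variable F : U -> sdprod (actKb b).
Hypothesis FM : {morph F : u v / (u * v)%g}.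
Hypothesis Fgen : forall t, F (rg_gen U t) = refl_triple b t.

Lemma image1 : F 1%g = tr 0 0 1%g.
Proof. by apply: (mulgI (F 1%g)); rewrite -FM !mulg1. Qed.

Lemma imageV u : F u^-1%g = (F u)^-1%g.
Proof. by apply: (mulgI (F u)); rewrite -FM !mulgV image1. Qed.

Lemma triple_1M z k z' k' : (tr z k 1 * tr z' k' 1)%g = tr (z + z' + b k k') (k + k') 1%g.
Proof. by rewrite tripleM actK1 mulg1. Qed.

Lemma triple_1V z k : ((tr z k 1)^-1)%g = tr (- z) (- k) 1%g.
Proof.
by apply: mulg1_eq; rewrite triple_1M bihNr bih_alt !subrr ?oppr0 ?addr0.
Qed.

Lemma image_rgen a g : slice a g -> exists k (v : weyl_group D),
  [/\ F (rgen U g a) = tr 0 k v, Kval k = tensor g a & val v = refl_lat a].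
Proof.
move=> Sg; rewrite (rgenE U Sg) Fgen refl_tripleE.
have e : sval (refl_elt Sg) = ext_refl (g, a) by [].
exists (reflK (refl_elt Sg)), (reflV (refl_elt Sg)); split=> //.
  exact: reflKE e.
exact: reflVE e.
Qed.

Lemma image_xgen a g : slice a g ->
  exists2 k, F (x a g) = tr 0 k 1%g & Kval k = tensor g a.
Proof.
move=> Sg; have [k [v [e kE vE]]] := image_rgen Sg.
have [k0 [v0 [e0 k0E v0E]]] := image_rgen (slice0 Rx a).
have k00 : k0 = 0.
  by apply: Kval_inj; apply/funext => m; rewrite k0E /tensor mul0rz.
have vv : v0 = v by apply: val_inj; rewrite vE v0E.
have v2 : (v * v)%g = 1%g.
  by apply: val_inj; rewrite [LHS]valM vE; apply: autP => m; exact: refl_latK.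
have a0 : actK v (0 : Kgroup Rx) = 0 by apply: Kval_inj; apply/funext.
exists k => //.
by rewrite /xgen FM e e0 k00 vv tripleM v2 a0 bih0r !addr0.
Qed.

(** The product (h - g) (g) (- h) in K^b has vanishing K component, and its central
    component is b((h - g) (x) a^v, g (x) a^v). *)
Lemma image_defect a g h : slice a g -> slice a h -> slice a (h - g) ->
  F (defect (x a) g h) =
  tr (dot (coroot (root_val a)) (coroot (root_val a)) * wedge phi psi h g) 0 1%g.
Proof.
move=> Sg Sh Shg.
have [k1 e1 k1E] := image_xgen Shg.
have [k2 e2 k2E] := image_xgen Sg.
have [k3 e3 k3E] := image_xgen (sliceN Sh).
have k12 : k1 + k2 = - k3.
  apply: Kval_inj; apply/funext => m; rewrite KvalD k1E k2E -[- k3]sub0r KvalB k3E.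
  by rewrite sub0r /tensor -mulrzDl subrK mulNrz opprK.
rewrite /defect FM FM e1 e2 e3 !triple_1M k12 bihNl bih_alt addNr oppr0 !addr0 !add0r.
congr (tr _ _ _); rewrite (wedge_bihomE phi psi k1E k2E); congr (_ * _).
by rewrite /wedge !raddfB; ring.
Qed.

Hypothesis simple_neighbour : forall i, exists b, adjacent (sg i) b.

Lemma image_simple_defect i g h : slice (sg i) g -> slice (sg i) h ->
  F (defect (x (sg i)) g h) = tr (dot (coroot (root_val (sg i)))
    (coroot (root_val (sg i))) * wedge phi psi h g) 0 1%g.
Proof.
move=> Sg Sh; apply: image_defect => //.
by have [c /(slice_subgroup Rx)[_ SB]] := simple_neighbour i; apply: SB.
Qed.

Lemma image_defect_group u : defect_group s u -> exists z, F u = tr z 0 1%g.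
Proof.
pose P : set U := [set u | exists z, F u = tr z 0 1%g].
apply: (gspan_ind (P := P)) => [_ [i [g [h [Sg Sh ->]]]]||v v' [z e] [z' e']|v [z e]].
- by eexists; exact: image_simple_defect.
- by exists 0; exact: image1.
- by exists (z + z'); rewrite FM e e' triple_1M bih0l !addr0.
- by exists (- z); rewrite imageV e triple_1V oppr0.
Qed.

Lemma image_normal_form gam : slice_family Rx s gam -> exists z k,
  F (normal_form U s gam) = tr z k 1%g /\
  forall m, Kval k m = \sum_(i < l) gam i *~ pairing (sg i) m.
Proof.
move=> Sgam; rewrite /normal_form; elim: (index_enum _) => [|i r [z [k [e kE]]]].
  by exists 0, 0; rewrite big_nil; split=> [|m]; [exact: image1|rewrite big_nil].
have [k' e' kE'] := image_xgen (Sgam i).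
rewrite big_cons FM e e' triple_1M; do 2!eexists; split=> // m.
by rewrite big_cons KvalD kE kE'.
Qed.

Lemma image_word t : exists z k (v : weyl_group D), F (word_elt U s t) = tr z k v /\
  forall c, root_lat (act_word s t c) = val v (root_lat c).
Proof.
elim: t => [|i t [z [k [v [e vE]]]]].
  by exists 0, 0, 1%g; split; [exact: image1|].
have [k' [v' [e' _ vE']]] := image_rgen (slice0 Rx (sg i)).
rewrite /= FM e -[F (wgen U (sg i))]/(F (rgen U 0 (sg i))) e' tripleM.
do 3!eexists; split=> // c.
change (root_lat (refl_root (sg i) (act_word s t c)) = val v' (val v (root_lat c))).
by rewrite root_lat_refl vE vE'.
Qed.

Lemma triple_inj z k (v : weyl_group D) z' k' (v' : weyl_group D) : tr z k v = tr z' k' v' -> [/\ z = z', k = k' & v = v'].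
Proof. by case. Qed.

Lemma image_kernel (z : U) gam t : defect_group s z -> slice_family Rx s gam ->
  F (z * normal_form U s gam * word_elt U s t)%g = 1%g ->
  (forall c, act_word s t c = c) /\
  (forall c, phi (\sum_(i < l) gam i *~ cartan (sg i) c) = 0).
Proof.
move=> Cz Sgam; have [z0 e0] := image_defect_group Cz.
have [z1 [k1 [e1 k1E]]] := image_normal_form Sgam.
have [z2 [k2 [v2 [e2 v2E]]]] := image_word t.
rewrite FM FM e0 e1 e2 triple_1M tripleM => /triple_inj[_ k10].
rewrite mul1g => v21; have fixt c : act_word s t c = c.
  apply: root_eq; have := congr1 (@lat_val R n D) (v2E c); rewrite v21.
  by [].
split=> // c; move: e2; rewrite word_elt_faithful //.
rewrite image1 => /triple_inj[_ k20 _].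
move: k10; rewrite -k20 actK1 add0r addr0 => k10.
by rewrite -[\sum_(i < l) _](k1E (root_lat c)) k10 raddf0.
Qed.

End Image.

Section Kernel.
Variables (R : realType) (n : nat) (D : rootSystem R n) (G : zmodType).
Variable (Rx : extRootSystem D G).
Variables (U : reflGroup (refl_system Rx)) (Z : zmodType) (w : invariantBihom Rx Z).
Variables (hw : is_universal_admissible w) (f : U -> ext_weyl_group hw).
Hypothesis fP : is_refl_morphism f.
Variables (l : nat) (s : l.-tuple (Defs.root D)).
Hypothesis base : is_base s.
Local Notation sg := (tnth s).
Hypothesis simple_neighbour : forall i, exists b, adjacent (sg i) b.
Hypothesis simple_link : forall i j, linked (sg i) (sg j).
Hypothesis separated : forall g : G,
  (forall phi : {additive G -> R}, phi g = 0) -> g = 0.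

(** The simple coroots are proportional to the simple roots, hence independent, and a vector
    orthogonal to all roots is zero. *)
Lemma coroot_comb_eq0 (q : 'I_l -> R) :
  (forall c, \sum_(i < l) q i * (cartan (sg i) c)%:~R = 0) -> forall i, q i = 0.
Proof.
move=> q0 i.
have e : \sum_(j < l) q j *: coroot (root_val (sg j)) = 0.
  apply: (@dot_roots_inj R n D) => c; rewrite [RHS]dotC dot0r -[RHS](q0 c).
  rewrite (big_morph (fun v => dot v (root_val c)) (id1 := 0) (op1 := +%R)).
  - by apply: eq_bigr => j _; rewrite dotZl cartanE.
  - by move=> ? ?; rewrite dotDl.
  - by rewrite dotC dot0r.
have := congr1 (coord [tuple of map (@root_val R n D) s] i) e.
rewrite linear0 linear_sum /= (bigD1 i) //= big1 ?addr0 => [|j ji].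
  rewrite !linearZ /= -[coord _ _ _]/(scoord s i (sg i)) (scoord_simple base) eqxx mulr1.
  move/eqP; rewrite mulf_eq0 => /orP[/eqP//|].
  by rewrite mulf_eq0 invr_eq0 pnatr_eq0 (negPf (root_normN0 _)).
rewrite !linearZ /= -[coord _ _ _]/(scoord s i (sg j)) (scoord_simple base).
by rewrite eq_sym (negPf ji) !mulr0.
Qed.

(** The Weyl component of the detecting homomorphisms kills the word, and the K
    component kills the coordinates of the normal form. *)
Lemma kernel_defect_group u : f u = 1%g -> defect_group s u.
Proof.
move=> fu; have [z [gam [t [Cz Sgam ue]]]] := decomposition base simple_neighbour simple_link u.
have ker (phi psi : {additive G -> R}) : (forall c, act_word s t c = c) /\
    (forall c, phi (\sum_(i < l) gam i *~ cartan (sg i) c) = 0).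
  have [F [FM Fgen Fker]] := detection fP phi psi.
  apply: (image_kernel base FM Fgen simple_neighbour Cz Sgam).
  by rewrite -ue; exact: Fker.
have gam0 i : gam i = 0.
  apply: separated => phi; move: i; apply: coroot_comb_eq0 => c.
  have [_ /(_ c)] := ker phi phi.
  by rewrite raddf_sum => e; rewrite -[RHS]e; apply: eq_bigr => i _; rewrite raddfMz mulrzr.
have -> : u = z; last by [].
rewrite ue word_elt_faithful //; last first.
  by have [] := ker (\0 : {additive G -> R}) (\0 : {additive G -> R}).
rewrite mulg1 /normal_form big1 ?mulg1 // => i _.
by rewrite gam0 xgen0.
Qed.
End Kernel.

(** * Alternating maps on a free abelian group *)
Section Coordinates.
Variable G : zmodType.
Implicit Types (x g h : G) (c : G -> int) (s : seq G).

(** Coordinates are indexed by all elements of G instead of the basis only, with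
    value 0 outside of the basis; any list containing the support expands g. *)
Lemma free_coordinates : is_free_abelian G -> exists cr : G -> G -> int,
  (forall x, zmod_morphism (cr x)) /\
  forall g, exists s, forall t, uniq t -> {subset s <= t} -> g = \sum_(x <- t) x *~ cr x g.
Proof.
case=> B [Bgen Bfree].
pose rep g c := exists s, [/\ uniq s, forall x, x \in s -> B x,
  forall x, x \notin s -> c x = 0 & g = \sum_(x <- s) x *~ c x].
have widen s t c : uniq s -> uniq t -> {subset s <= t} ->
    (forall x, x \notin s -> c x = 0) -> \sum_(x <- s) x *~ c x = \sum_(x <- t) x *~ c x.
  move=> us ut st cs.
  rewrite [RHS](bigID (mem s)) /= [X in _ = _ + X]big1 ?addr0; last first.
    by move=> x /cs ->; rewrite mulr0z.
  rewrite -[RHS]big_filter; apply: perm_big; apply: uniq_perm; rewrite ?filter_uniq //.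
  by move=> x; rewrite mem_filter andb_idr //; apply: st.
have rep_sub g h c d : rep g c -> rep h d -> rep (g - h) (fun x => c x - d x).
  move=> [s [us sB sc ->]] [t [ut tB tc ->]]; exists (undup (s ++ t)).
  have sub1 : {subset s <= undup (s ++ t)} by move=> x; rewrite mem_undup mem_cat => ->.
  have sub2 : {subset t <= undup (s ++ t)}.
    by move=> x; rewrite mem_undup mem_cat orbC => ->.
  split; first exact: undup_uniq.
  - by move=> x; rewrite mem_undup mem_cat => /orP[/sB|/tB].
  - by move=> x; rewrite mem_undup mem_cat negb_or => /andP[/sc -> /tc ->].
  - rewrite (widen s (undup (s ++ t))) ?undup_uniq // (widen t (undup (s ++ t))) ?undup_uniq //.
    by rewrite -sumrB; apply: eq_bigr => x _; rewrite mulrzBr.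
have rep0 c : rep 0 c -> forall x, c x = 0.
  move=> [s [us sB sc /esym/(Bfree _ _ us sB) c0]] x.
  by have [/c0//|/sc] := boolP (x \in s).
have rep_ex g : exists c, rep g c.
  have : zspan B g by rewrite Bgen.
  pose P : set G := [set g | exists c, rep g c].
  apply: (zspan_ind (P := P)) => [x Bx||y z [c cy] [d dz]].
  - exists (fun y => (y == x)%:Z); exists [:: x]; split=> //.
    + by move=> y; rewrite inE => /eqP ->.
    + by move=> y; rewrite inE => /negPf ->.
    + by rewrite big_seq1 eqxx.
  - by exists (fun=> 0), [::]; split=> //; rewrite big_nil.
  - by exists (fun x => c x - d x); exact: rep_sub.
pose cr x g := projT1 (cid (rep_ex g)) x.
have crP g : rep g (cr^~ g) by rewrite /cr; case: cid.
exists cr; split=> [x g h|g].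
  have := rep_sub _ _ _ _ (crP (g - h)) (rep_sub _ _ _ _ (crP g) (crP h)).
  by rewrite subrr => /rep0/(_ x)/eqP; rewrite subr_eq0 => /eqP.
have [s [us sB sc e]] := crP g; exists s => t ut st.
by rewrite {1}e; exact: widen.
Qed.
End Coordinates.

Section Alternating.
Variables (G W : zmodType) (A : G -> G -> W) (cr : G -> G -> int).
Hypothesis ADl : forall g h k, A (g + h) k = A g k + A h k.
Hypothesis ADr : forall g h k, A k (g + h) = A k g + A k h.
Hypothesis Agg : forall g, A g g = 0.
Hypothesis crE : forall g, exists s : seq G,
  forall t, uniq t -> {subset s <= t} -> g = \sum_(x <- t) x *~ cr x g.

Let Al h : zmod_morphism (A^~ h).
Proof. by move=> g g' /=; rewrite -{2}[g](subrK g') (ADl (g - g') g') addrK. Qed.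
Let Ar g : zmod_morphism (A g).
Proof. by move=> h h' /=; rewrite -{2}[h](subrK h') (ADr (h - h') h') addrK. Qed.

Lemma alternating_anti g h : A h g = - A g h.
Proof.
apply/eqP; rewrite -addr_eq0; have := Agg (g + h).
by rewrite ADl !ADr !Agg add0r addr0 addrC => ->.
Qed.

Lemma alternating_expand (L : seq (G * G)) : exists t : seq G,
  \sum_(p <- L) A p.1 p.2 =
  \sum_(x <- t) \sum_(y <- t) A x y *~ (\sum_(p <- L) cr x p.1 * cr y p.2).
Proof.
have [t [ut tE]] : exists t, uniq t /\ forall p, p \in L ->
    p.1 = \sum_(x <- t) x *~ cr x p.1 /\ p.2 = \sum_(x <- t) x *~ cr x p.2.
  have [t tE] : exists t : seq G, forall u : seq G, uniq u -> {subset t <= u} -> forall p, p \in L ->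
      p.1 = \sum_(x <- u) x *~ cr x p.1 /\ p.2 = \sum_(x <- u) x *~ cr x p.2.
    elim: L => [|p L [t tE]]; first by exists [::].
    have [s1 s1E] := crE p.1; have [s2 s2E] := crE p.2.
    exists (s1 ++ s2 ++ t) => u uu su q; rewrite inE => /predU1P[->|].
      by split; [apply: (s1E u uu)|apply: (s2E u uu)] => x xs; apply: su; rewrite !mem_cat xs ?orbT.
    by apply: tE => // x xs; apply: su; rewrite !mem_cat xs !orbT.
  exists (undup t); split; first exact: undup_uniq.
  by apply: tE; rewrite ?undup_uniq // => x; rewrite mem_undup.
exists t.
pose Aladd h : {additive G -> W} :=
  HB.pack (A^~ h) (GRing.isZmodMorphism.Build G W (A^~ h) (Al h)).
pose Aradd g : {additive G -> W} :=
  HB.pack (A g) (GRing.isZmodMorphism.Build G W (A g) (Ar g)).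
have Al_sum (c : G -> int) h : A (\sum_(x <- t) x *~ c x) h = \sum_(x <- t) A x h *~ c x.
  rewrite -[LHS]/(Aladd h _) raddf_sum; apply: eq_bigr => x _; exact: raddfMz.
have Ar_sum (c : G -> int) g : A g (\sum_(x <- t) x *~ c x) = \sum_(x <- t) A g x *~ c x.
  rewrite -[LHS]/(Aradd g _) raddf_sum; apply: eq_bigr => x _; exact: raddfMz.
rewrite big_seq (eq_bigr (fun p => \sum_(x <- t) \sum_(y <- t) A x y *~ (cr x p.1 * cr y p.2))).
  rewrite -big_seq exchange_big; apply: eq_bigr => x _.
  rewrite exchange_big; apply: eq_bigr => y _.
  by rewrite mulrz_sumr.
move=> p /tE[e1 e2]; rewrite {1}e1 {1}e2 Al_sum; apply: eq_bigr => x _.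
rewrite Ar_sum mulrz_suml; apply: eq_bigr => y _.
by rewrite -mulrzA mulrC.
Qed.

(** Expand the sum in coordinates: the matrix of coefficients of the tensor is symmetric by
    hypothesis, and the sum of its products with an alternating matrix is 0. *)
Lemma alternating_eq0 (L : seq (G * G)) :
  (forall x y, \sum_(p <- L) (cr x p.1 * cr y p.2 - cr y p.1 * cr x p.2) = 0) ->
  \sum_(p <- L) A p.1 p.2 = 0.
Proof.
move=> L0; have [t ->] := alternating_expand L.
set N := fun x y => \sum_(p <- L) cr x p.1 * cr y p.2.
have Nsym x y : N x y = N y x.
  by apply/eqP; rewrite -subr_eq0 -sumrB L0.
rewrite -[LHS]/(\sum_(x <- t) \sum_(y <- t) A x y *~ N x y).
elim: t => [|z t IH]; first by rewrite big_nil.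
rewrite big_cons big_cons Agg mul0rz add0r.
under [X in _ + X]eq_bigr => x _ do rewrite big_cons.
rewrite big_split /= IH addr0 -big_split big1 // => x _ /=.
by rewrite (alternating_anti z x) mulNrz Nsym subrr.
Qed.
End Alternating.

(** * The centre of a group, written additively *)
Section Centre.
Variable U : groupType.

Definition central_elt : pred U := fun u => `[< forall v, commute u v >].
Definition centre : Type := {u : U | central_elt u}.
HB.instance Definition _ := SubChoice.on centre.
Implicit Types z : centre.
Definition centre_elt (u : U) (cu : central_elt u) : centre :=
  exist (fun u => is_true (central_elt u)) u cu.

Lemma centreP z v : commute (val z) v.
Proof. by have /asboolP := valP z; apply. Qed.

Fact central1 : central_elt 1%g.
Proof. by apply/asboolP => v; exact/commute_sym/commute1. Qed.
Fact centralM z z' : central_elt (val z * val z')%g.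
Proof. by apply/asboolP => v; apply/commute_sym/commuteM; apply/commute_sym/centreP. Qed.
Fact centralV z : central_elt (val z)^-1%g.
Proof. by apply/asboolP => v; apply/commute_sym/commuteV/commute_sym/centreP. Qed.

Definition centre_zero : centre := centre_elt central1.
Definition centre_add z z' : centre := centre_elt (centralM z z').
Definition centre_opp z : centre := centre_elt (centralV z).
Fact centre_addA : associative centre_add.
Proof. by move=> x y z; apply: val_inj; exact: mulgA. Qed.
Fact centre_addC : commutative centre_add.
Proof. by move=> x y; apply: val_inj; exact: centreP. Qed.
Fact centre_add0 : left_id centre_zero centre_add.
Proof. by move=> x; apply: val_inj; exact: mul1g. Qed.
Fact centre_addN : left_inverse centre_zero centre_opp centre_add.
Proof. by move=> x; apply: val_inj; exact: mulVg. Qed.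
HB.instance Definition _ :=
  GRing.isZmodule.Build centre centre_addA centre_addC centre_add0 centre_addN.

(** Total, with default value 0, so that defects define maps into the centre. *)
Definition to_centre (u : U) : centre :=
  if pselect (central_elt u) is left c then centre_elt c else 0.

Lemma to_centreK u : (forall v, commute u v) -> val (to_centre u) = u.
Proof. by move=> cu; rewrite /to_centre; case: pselect => // -[]; apply/asboolP. Qed.

Lemma centre_valD z z' : val (z + z') = (val z * val z')%g. Proof. by []. Qed.
Lemma centre_valN z : val (- z) = (val z)^-1%g. Proof. by []. Qed.
Lemma centre_val0 : val (0 : centre) = 1%g. Proof. by []. Qed.
End Centre.

(** * Trivial kernel, from one alternating map that generates the defects *)
Section Core.
Variables (R : realType) (n : nat) (D : rootSystem R n) (G : zmodType).
Variable (Rx : extRootSystem D G).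
Variables (U : reflGroup (refl_system Rx)) (Z : zmodType) (w : invariantBihom Rx Z).
Variables (hw : is_universal_admissible w) (f : U -> ext_weyl_group hw).
Hypothesis fP : is_refl_morphism f.
Variables (l : nat) (s : l.-tuple (Defs.root D)).
Hypothesis base : is_base s.
Local Notation sg := (tnth s).
Local Notation slice := (slice Rx).
Hypothesis simple_neighbour : forall i, exists b, adjacent (sg i) b.
Hypothesis simple_link : forall i j, linked (sg i) (sg j).
Hypothesis free : is_free_abelian G.
Implicit Types g h k : G.

Definition simple_defect i g h : centre U := to_centre (defect (xgen U (sg i)) g h).
Local Notation C := simple_defect.

Lemma simple_defect_val i g h : slice (sg i) g -> slice (sg i) h ->
  val (C i g h) = defect (xgen U (sg i)) g h.
Proof.
by move=> Sg Sh; apply: to_centreK => v;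
  exact: (simple_defect_central base simple_neighbour simple_link).
Qed.

Lemma slice_simple_subgroup i : is_zsubgroup (slice (sg i)).
Proof. by have [c adj] := simple_neighbour i; exact: slice_subgroup adj. Qed.

Lemma slice_simpleD i g h : slice (sg i) g -> slice (sg i) h -> slice (sg i) (g + h).
Proof.
have [_ SB] := slice_simple_subgroup i.
by move=> Sg Sh; rewrite -[h]opprK; apply: SB => //; exact: sliceN.
Qed.

Lemma simple_defectDl i g h k : slice (sg i) g -> slice (sg i) h -> slice (sg i) k ->
  C i (g + h) k = C i g k + C i h k.
Proof.
move=> Sg Sh Sk; have [c adj] := simple_neighbour i.
apply: val_inj; rewrite centre_valD !simple_defect_val //; last exact: slice_simpleD.
exact: (defectDl U adj).
Qed.

Lemma simple_defectC i g h : slice (sg i) g -> slice (sg i) h -> C i h g = - C i g h.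
Proof.
move=> Sg Sh; have [c adj] := simple_neighbour i.
apply: val_inj; rewrite [RHS](_ : _ = (val (C i g h))^-1)%g // !simple_defect_val //.
by rewrite (defectV U adj).
Qed.

Lemma simple_defectDr i g h k : slice (sg i) g -> slice (sg i) h -> slice (sg i) k ->
  C i k (g + h) = C i k g + C i k h.
Proof.
move=> Sg Sh Sk; rewrite simple_defectC //; last exact: slice_simpleD.
by rewrite simple_defectDl // opprD -!simple_defectC.
Qed.

Lemma simple_defectgg i g : slice (sg i) g -> C i g g = 0.
Proof.
move=> Sg; have [c adj] := simple_neighbour i.
by apply: val_inj; rewrite simple_defect_val // (defectgg U adj).
Qed.

Lemma adjacent_simple_defect i j g h : adjacent (sg i) (sg j) ->
  slice (sg i) g -> slice (sg i) h -> C i g h = C j g h.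
Proof. by move=> adj Sg Sh; rewrite /simple_defect (adjacent_defect U adj). Qed.

(* i0 is a short and i1 a long simple root, and pr is the projection of G onto G2.  With one
   root length, pr = 0. *)
Variables (i0 i1 : 'I_l) (pr : {additive G -> G}).
Hypothesis slice_i0 : forall g, slice (sg i0) g.
Hypothesis slice_pr : forall g, slice (sg i1) (pr g).
Hypothesis pr_idem : forall g, pr (pr g) = pr g.

(** The short defect F_sh, except on G2 x G2 where it is the long defect F_lg: there F_sh is
    a multiple of F_lg by k, so that F_sh alone would not generate all defects. *)
Definition twist_defect g h : centre U :=
  C i0 g h - C i0 (pr g) (pr h) + C i1 (pr g) (pr h).
Local Notation A := twist_defect.

Lemma twist_defectDl g h k : A (g + h) k = A g k + A h k.
Proof.
rewrite /twist_defect raddfD !simple_defectDl // opprD.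
by rewrite (addrACA (C i0 g k)) [LHS]addrACA.
Qed.

Lemma twist_defectgg g : A g g = 0.
Proof. by rewrite /twist_defect !simple_defectgg // subrr addr0. Qed.

Lemma twist_defectDr g h k : A k (g + h) = A k g + A k h.
Proof.
have e p q : A p q = - A q p.
  rewrite /twist_defect !opprD opprK (simple_defectC (slice_i0 p) (slice_i0 q)).
  rewrite (simple_defectC (slice_i0 (pr p)) (slice_i0 (pr q))).
  by rewrite (simple_defectC (slice_pr p) (slice_pr q)) !opprK.
by rewrite e twist_defectDl opprD -!e.
Qed.

Definition twist_span : set (centre U) :=
  [set z | exists L : seq (G * G), z = \sum_(p <- L) A p.1 p.2].

Lemma twist_span_gen g h : twist_span (A g h).
Proof. by exists [:: (g, h)]; rewrite big_seq1. Qed.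

Lemma twist_span_sub : is_zsubgroup twist_span.
Proof.
split=> [|_ _ [L ->] [L' ->]]; first by exists [::]; rewrite big_nil.
exists (L ++ [seq (- p.1, p.2) | p <- L']); rewrite big_cat big_map /=; congr (_ + _).
rewrite -sumrN; apply: eq_bigr => p _.
have A0 : A 0 p.2 = 0.
  by have /eqP := twist_defectDl 0 0 p.2; rewrite addr0 addrC -subr_eq subrr => /eqP <-.
by apply/eqP; rewrite eq_sym -addr_eq0 -twist_defectDl addNr A0.
Qed.

Hypothesis defects_span : forall i g h, slice (sg i) g -> slice (sg i) h ->
  twist_span (C i g h).

Lemma defect_group_span u : defect_group s u -> exists2 z, twist_span z & u = val z.
Proof.
have [T0 TB] := twist_span_sub.
have TN z : twist_span z -> twist_span (- z).
  by move=> Tz; rewrite -sub0r; exact: TB.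
pose P : set U := [set u | exists2 z, twist_span z & u = val z].
apply: (gspan_ind (P := P)) => [_ [i [g [h [Sg Sh ->]]]]||_ _ [z Tz ->] [z' Tz' ->]|_ [z Tz ->]].
- by exists (C i g h); [exact: defects_span|rewrite simple_defect_val].
- by exists 0.
- by exists (z + z') => //; rewrite -[z']opprK; apply: TB => //; exact: TN.
- by exists (- z) => //; exact: TN.
Qed.

(** For u = sum of A(g, h) over a list, detection gives, for all phi and psi,
      sum of N0 (phi /\ psi)(h, g) + (N1 - N0) (phi /\ psi)(pr h, pr g) = 0,
    where N0 and N1 are the squared lengths of the two coroots.  The choice of
    phi o pr and psi o pr removes the second term, and the choice of coordinate functions
    then shows that the list represents 0 in the exterior square of G. *)
Lemma kernel_trivial u : f u = 1%g -> u = 1%g.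
Proof.
move=> fu; have [cr [crB crE]] := free_coordinates free.
have separated g : (forall phi : {additive G -> R}, phi g = 0) -> g = 0.
  move=> sep; have [t tE] := crE g.
  have -> : g = \sum_(x <- undup t) x *~ cr x g.
    by apply: tE; rewrite ?undup_uniq // => x; rewrite mem_undup.
  rewrite big1 // => x _.
  pose crx : {additive G -> int} :=
    HB.pack (cr x) (GRing.isZmodMorphism.Build G int (cr x) (crB x)).
  have /eqP := sep (intr \o crx : {additive G -> R}).
  by rewrite /= intr_eq0 => /eqP ->; rewrite mulr0z.
have [z [L zE] uE] : exists2 z, twist_span z & u = val z.
  apply: defect_group_span.
  exact: (kernel_defect_group fP base simple_neighbour simple_link separated).
suff z0 : z = 0 by rewrite uE z0.
rewrite zE; apply: (alternating_eq0 twist_defectDl twist_defectDr twist_defectgg crE).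
pose N i : R := dot (coroot (root_val (sg i))) (coroot (root_val (sg i))).
have Npos i : 0 < N i.
  have c0 : coroot (root_val (sg i)) != 0.
    rewrite scaler_eq0 negb_or mulf_neq0 ?pnatr_eq0 ?invr_eq0 ?root_normN0 //=.
    by rewrite -dot_eq0 root_normN0.
  by rewrite lt_def dot_eq0 c0 sumr_ge0 // => j _; exact: sqr_ge0.
have det (phi psi : {additive G -> R}) :
  \sum_(p <- L) (N i0 * wedge phi psi p.2 p.1 +
     (N i1 - N i0) * wedge phi psi (pr p.2) (pr p.1)) = 0.
  have [F [FM Fgen Fker]] := detection fP phi psi.
  have valF : F (val z) = triple _ (\sum_(p <- L) (N i0 * wedge phi psi p.2 p.1 +
     (N i1 - N i0) * wedge phi psi (pr p.2) (pr p.1))) 0 1%g.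
    rewrite zE; elim: {z zE uE}L => [|p L IH].
      by rewrite !big_nil centre_val0; exact: image1 FM.
    rewrite !big_cons centre_valD FM IH.
    have eN i g h : slice (sg i) g -> slice (sg i) h ->
        F (val (C i g h)) = triple _ (N i * wedge phi psi h g) 0 1%g.
      move=> Sg Sh; rewrite simple_defect_val //.
      exact: (image_simple_defect FM Fgen simple_neighbour).
    have -> : F (val (A p.1 p.2)) = triple _ (N i0 * wedge phi psi p.2 p.1 +
        (N i1 - N i0) * wedge phi psi (pr p.2) (pr p.1)) 0 1%g.
      rewrite /A !centre_valD FM FM eN // eN //.
      rewrite centre_valN (imageV FM) eN // triple_1V !triple_1M oppr0 !bih0l !addr0.
      by congr (triple _ _ _ _); rewrite ?bih0l; ring.
    by rewrite triple_1M bih0l !addr0.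
  by move: (Fker _ fu); rewrite uE valF => /triple_inj[].
move=> x y.
pose crx x : {additive G -> int} :=
  HB.pack (cr x) (GRing.isZmodMorphism.Build G int (cr x) (crB x)).
pose e x : {additive G -> R} := intr \o crx x.
have d1 := det (e x) (e y); have d2 := det (e x \o pr) (e y \o pr).
pose Q : R := \sum_(p <- L) wedge (e x) (e y) p.2 p.1.
pose Q' : R := \sum_(p <- L) wedge (e x) (e y) (pr p.2) (pr p.1).
have Q'0 : Q' = 0.
  have : N i1 * Q' = 0.
    rewrite -[RHS]d2 /Q' mulr_sumr; apply: eq_bigr => p _.
    by rewrite /wedge /= !pr_idem; ring.
  by move/eqP; rewrite mulf_eq0 gt_eqF //= => /eqP.
have : N i0 * Q = 0.
  rewrite -[RHS]d1 big_split /= -!mulr_sumr -/Q -/Q' Q'0.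
  by rewrite mulr0 addr0.
move/eqP; rewrite mulf_eq0 gt_eqF //= => /eqP Q0.
apply: (@intr_inj R); rewrite rmorph_sum /= -[RHS]oppr0 -[in RHS]Q0 -sumrN.
by apply: eq_bigr => p _; rewrite /wedge /= rmorphB /= !rmorphM /=; ring.
Qed.

End Core.

(** * One and two root lengths *)
Lemma refl_morphism_bijective (T : symSystem) (X Y : reflGroup T) (f : X -> Y) :
  is_refl_morphism f -> (forall u, f u = 1%g -> u = 1%g) -> bijective f.
Proof.
move=> [fM fgen] ker.
have f1 : f 1%g = 1%g by apply: (mulgI (f 1%g)); rewrite -fM !mulg1.
have fV u : f u^-1%g = (f u)^-1%g by apply: (mulgI (f u)); rewrite -fM !mulgV.
have finj : injective f.
  by move=> u v uv; apply/divg1_eq/ker; rewrite fM fV uv mulgV.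
have fsurj y : exists u, f u = y.
  have : gspan (range (rg_gen Y)) y by rewrite (rg_G1 (rg_prop Y)).
  pose P : set Y := [set y | exists u, f u = y].
  apply: (gspan_ind (P := P)) => [_ [t _ <-]||_ _ [u <-] [v <-]|_ [u <-]].
  - by exists (rg_gen X t).
  - by exists 1%g.
  - by exists (u * v)%g.
  - by exists (u^-1)%g.
pose g y := projT1 (cid (fsurj y)).
have gK : cancel g f by move=> y; rewrite /g; case: cid.
by exists g => // u; apply: finj; rewrite gK.
Qed.

Section Criteria.
Variables (R : realType) (n : nat) (D : rootSystem R n) (G : zmodType).
Variable (Rx : extRootSystem D G).
Variables (U : reflGroup (refl_system Rx)) (Z : zmodType) (w : invariantBihom Rx Z).
Variables (hw : is_universal_admissible w) (f : U -> ext_weyl_group hw).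
Hypothesis fP : is_refl_morphism f.
Variables (l : nat) (s : l.-tuple (Defs.root D)).
Hypothesis base : is_base s.
Local Notation sg := (tnth s).
Local Notation slice := (slice Rx).
Hypothesis simple_neighbour : forall i, exists b, adjacent (sg i) b.
Hypothesis simple_link : forall i j, linked (sg i) (sg j).
Hypothesis free : is_free_abelian G.
Implicit Types g h k : G.
Local Notation C := (simple_defect U s).

(** Slices are constant on orbits of roots, and all slices together generate G. *)
Lemma zspan_slices_sub (B : set G) : is_zsubgroup B ->
  (forall i g, slice (sg i) g -> B g) -> forall g, B g.
Proof.
move=> Bsub Bs g; have : zspan [set g | exists a : Defs.root D, ers Rx (g, a)] g.
  by rewrite ers_R1.
apply; split=> // h [a Sh]; have [t [i ai]] := simple_orbit base a.
apply: (Bs i); rewrite -(slice_word Rx s t) -ai; exact: Sh.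
Qed.

Section OneLength.
Variable i0 : 'I_l.
Hypothesis same_slice : forall i, slice (sg i) = slice (sg i0).
Hypothesis same_defect : forall i g h, slice (sg i) g -> slice (sg i) h -> C i g h = C i0 g h.

Lemma one_length_kernel u : f u = 1%g -> u = 1%g.
Proof.
have full g : slice (sg i0) g.
  apply: zspan_slices_sub => [|i h]; first exact: slice_simple_subgroup.
  by rewrite same_slice.
have slice0' g : slice (sg i0) ((\0 : {additive G -> G}) g) by exact: full.
apply: (kernel_trivial fP base simple_neighbour simple_link free full slice0') => //.
move=> i g h Sg Sh; rewrite same_defect //.
have -> : C i0 g h = twist_defect U s i0 i0 (\0 : {additive G -> G}) g h.
  by rewrite /twist_defect subrK.
exact: twist_span_gen.
Qed.
End OneLength.

(** Compute the commutator of x_i(g) and x_j(h) as a defect of j, and, with the roots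
    exchanged, as a defect of i. *)
Lemma simple_defect_mixed i j (m : nat) g h :
  cartan (sg i) (sg j) = - m%:Z -> cartan (sg j) (sg i) = -1 ->
  slice (sg i) g -> slice (sg j) h -> slice (sg i) h ->
  C j h (g *+ m) = C i h g.
Proof.
move=> cij cji Sg Sh Sih.
have e1 := xgen_comm U Sg Sh; have e2 := xgen_comm U Sh Sg.
rewrite cij mulNrz mulrNz opprK -pmulrn in e1.
rewrite cji mulNrz mulrNz opprK mulr1z in e2.
have Sm : slice (sg j) (g *+ m).
  have := slice_shift Sg (slice0 Rx (sg j)).
  by rewrite cij mulrNz opprK add0r -pmulrn.
rewrite (simple_defectC U base simple_neighbour simple_link Sm Sh).
apply: val_inj; rewrite centre_valN.
rewrite !(simple_defect_val U base simple_neighbour simple_link) // -e1 -e2.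
by free_reduce.
Qed.

(** The predicate [sh] singles out the short simple roots; [i0] and [i1] are a short and a long
    simple root joined in the Dynkin diagram, and [m] is the square of the ratio of
    their lengths. *)
Section TwoLengths.
Variables (sh : pred 'I_l) (i0 i1 : 'I_l) (m : nat).
Hypotheses (sh0 : sh i0) (sh1 : ~~ sh i1).
Local Notation norm a := (dot (root_val a) (root_val a)).
Hypothesis norm_sh : forall i, norm (sg i) = norm (sg (if sh i then i0 else i1)).
Hypothesis norm_lt : norm (sg i0) < norm (sg i1).
Hypothesis slice_sh : forall i, slice (sg i) = slice (sg (if sh i then i0 else i1)).
Hypothesis defect_sh : forall i g h, slice (sg i) g -> slice (sg i) h ->
  C i g h = C (if sh i then i0 else i1) g h.
Hypothesis c01 : cartan (sg i0) (sg i1) = - m%:Z.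
Hypothesis c10 : cartan (sg i1) (sg i0) = -1.

Lemma slice_long_short g : slice (sg i1) g -> slice (sg i0) g.
Proof.
by move=> Sg; have := slice_shift Sg (slice0 Rx (sg i0)); rewrite c10 mulrNz opprK add0r.
Qed.

Lemma slice_short g : slice (sg i0) g.
Proof.
apply: zspan_slices_sub => [|i h]; first exact: slice_simple_subgroup.
by rewrite slice_sh; case: ifP => // _; exact: slice_long_short.
Qed.

Lemma slice_long_muln g : slice (sg i1) (g *+ m).
Proof.
have := slice_shift (slice_short g) (slice0 Rx (sg i1)).
by rewrite c01 mulrNz opprK add0r -pmulrn.
Qed.

Lemma norm_word t b : norm (act_word s t b) = norm b.
Proof. by elim: t => //= i t <-; exact: dot_reflection. Qed.

Lemma short_word t i : is_short (act_word s t (sg i)) <-> sh i.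
Proof.
split=> [short|shi].
  apply: contraTT norm_lt => nsh; rewrite -leNgt.
  by have := short (sg i0); rewrite norm_word norm_sh (negPf nsh).
move=> b; have [t' [j ->]] := simple_orbit base b.
rewrite !norm_word norm_sh shi (norm_sh j); case: ifP => // _; exact: ltW.
Qed.

Lemma S_shE : S_sh Rx = setT.
Proof.
apply/seteqP; split=> // g _; exists (sg i0); last exact: slice_short.
by apply/(short_word [::] i0).
Qed.

Lemma S_lgE : S_lg Rx = slice (sg i1).
Proof.
apply/seteqP; split=> g.
  move=> [b]; have [t [i ->]] := simple_orbit base b => lg.
  rewrite -[ers _ _]/(slice _ g) slice_word slice_sh; case: ifP => // shi.
  by case: lg; apply/short_word.
move=> Sg; exists (sg i1) => // /(short_word [::] i1).
by rewrite (negPf sh1).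
Qed.

Section Twist.
Variables G1 G2 : set G.
Hypothesis twist : is_twist_decomposition Rx G1 G2.
Hypothesis kE : k_factor D = m.

(** As S_sh is all of G, the first equation of a twist decomposition says that G2 is contained
    in S_lg, and the second that S_lg = m G1 + G2. *)
Lemma twist_projection : exists pr : {additive G -> G},
  [/\ forall g, slice (sg i1) (pr g), forall g, pr (pr g) = pr g
    & forall h, slice (sg i1) h -> exists g, h = g *+ m + pr h].
Proof.
have [[[G10 G1B] [G20 G2B] sum int] she lge] := twist.
rewrite S_shE S_lgE kE in she lge.
have zsub (A B : set G) : is_zsubgroup B -> zspan (A `&` B) `<=` B.
  by move=> Bs x; apply; split=> // y [].
have zsub1 (A B : set G) : is_zsubgroup A -> zspan (A `&` B) `<=` A.
  by move=> As x; apply; split=> // y [].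
have dec g : exists2 y, G2 y & G1 (g - y).
  have : [set x + y | x in G1 & y in G2] g by rewrite sum.
  by move=> [x xG1 [y yG2 <-]]; exists y; rewrite // addrK.
have uniq y : G2 y -> G1 y -> y = 0.
  by move=> y2 y1; have : (G1 `&` G2) y by []; rewrite int.
pose p g := s2val (cid2 (dec g)).
have p2 g : G2 (p g) by rewrite /p; case: cid2.
have p1 g : G1 (g - p g) by rewrite /p; case: cid2.
have pu g y : G2 y -> G1 (g - y) -> p g = y.
  move=> y2 y1; apply/eqP; rewrite -subr_eq0; apply/eqP; apply: uniq; first exact: G2B.
  have -> : p g - y = (g - y) - (g - p g) by rewrite opprB [RHS]addrC addrA subrK.
  exact: G1B.
have pB : zmod_morphism p.
  move=> g h; apply: pu; first exact: G2B.
  have -> : g - h - (p g - p h) = (g - p g) - (h - p h).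
    by rewrite !opprB addrACA [RHS]addrACA; congr (_ + _); rewrite addrC.
  exact: G1B.
have sl := slice_simple_subgroup Rx simple_neighbour i1.
have p_id y : G2 y -> p y = y by move=> y2; apply: pu; rewrite ?subrr.
exists (HB.pack p (GRing.isZmodMorphism.Build G G p pB) : {additive G -> G}); split=> /=.
(* Write p g in G2 as x + y by the first equation: x lies in both summands. *)
- move=> g; have : [set: G] (p g) by [].
  rewrite she => -[x [_ x1] [y yz xy]].
  have y2 := zsub _ _ (conj G20 G2B) _ yz.
  have x0 : x = 0.
    apply: uniq => //; have -> : x = p g - y by rewrite -xy addrK.
    exact: G2B.
  by rewrite -xy x0 add0r; exact: zsub1 yz.
- by move=> g; exact: p_id.
- move=> h; rewrite {1}lge => -[x xz [y [_ y2] <-]]; exists x; congr (_ + _).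
  apply/esym/pu => //; rewrite addrK.
  have x1 : G1 x := zsub _ _ (conj G10 G1B) _ xz.
  elim: m => [|q IH]; first by rewrite mulr0n.
  by rewrite mulrS -[x *+ q]opprK; apply: (G1B) => //; rewrite -sub0r; exact: G1B.
Qed.

Lemma two_length_kernel u : f u = 1%g -> u = 1%g.
Proof.
have [pr [slpr prpr ldec]] := twist_projection.
apply: (kernel_trivial fP base simple_neighbour simple_link free slice_short slpr) => //.
have Dl i := @simple_defectDl _ _ _ _ _ U _ _ base simple_neighbour simple_link i.
have Dr i := @simple_defectDr _ _ _ _ _ U _ _ base simple_neighbour simple_link i.
set T : set (centre U) := twist_span s i0 i1 pr.
have [T0 TB] := twist_span_sub U base simple_neighbour simple_link slice_short slpr : is_zsubgroup T.
have TN y : T y -> T (- y) by move=> Ty; rewrite -sub0r; exact: TB.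
have TD x y : T x -> T y -> T (x + y).
  by move=> Tx Ty; rewrite -[y]opprK; exact: TB (TN _ Ty).
have Tgen g h : T (twist_defect U s i0 i1 pr g h) by exact: twist_span_gen.
have mixed h g : slice (sg i1) h -> C i1 h (g *+ m) = C i0 h g.
  by move=> Sh; apply: simple_defect_mixed => //; exact: slice_short.
(* T contains the long defects on G2, then the short ones on G2 by the relation F_lg(h, m g)
   = F_sh(h, g), then all short ones, and at last all long ones, by S_lg = m G + G2. *)
have T1p g h : T (C i1 (pr g) (pr h)).
  have := Tgen (pr g) (pr h); rewrite /twist_defect !prpr subrr add0r; exact.
have Tp g h : T (C i0 (pr g) (pr h)).
  have := T1p g (pr h *+ m); rewrite raddfMn prpr mixed //; exact.
have Ts g h : T (C i0 g h).
  have -> : C i0 g h = twist_defect U s i0 i1 pr g h +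
      (C i0 (pr g) (pr h) - C i1 (pr g) (pr h)).
    by rewrite /twist_defect addrACA subrK subrr addr0.
  by apply: TD => //; apply: TB.
have mixed' h g : slice (sg i1) h -> C i1 (g *+ m) h = C i0 g h.
  move=> Sh; have Sm := slice_long_muln g.
  rewrite (simple_defectC U base simple_neighbour simple_link Sh Sm) mixed //.
  by rewrite -(simple_defectC U base simple_neighbour simple_link) //; exact: slice_short.
have Tl g h : slice (sg i1) g -> slice (sg i1) h -> T (C i1 g h).
  move=> Sg Sh; have [g' ge] := ldec g Sg; have [h' he] := ldec h Sh.
  have Sm := slice_long_muln.
  rewrite ge Dl // mixed' //; apply: (TD) => //.
  by rewrite he Dr // mixed //; exact: TD (Ts _ _) (T1p _ _).
move=> i g h Sg Sh; rewrite defect_sh //; move: Sg Sh; rewrite slice_sh.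
by case: ifP => // _ Sg Sh; exact: Tl.
Qed.
End Twist.
End TwoLengths.
End Criteria.

(** * The Dynkin diagrams of the theorem *)
Lemma cartan_base (R : realType) (n : nat) (D : rootSystem R n) (l : nat) (C : 'M[int]_l) :
  has_cartan_matrix D C -> exists s : l.-tuple (Defs.root D),
    is_base s /\ forall i j, cartan (tnth s i) (tnth s j) = C i j.
Proof. by move=> [s [h1 h2 h3]]; exists s. Qed.

Lemma cartan_size (R : realType) (n : nat) (D : rootSystem R n) (l l' : nat)
    (C : 'M[int]_l) (C' : 'M[int]_l') :
  has_cartan_matrix D C -> has_cartan_matrix D C' -> l = l'.
Proof.
move=> [s [h _ _]] [s' [h' _ _]].
have e q (t : q.-tuple (Defs.root D)) : basis_of fullv (map (@root_val R n D) t) ->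
    \dim {:'rV[R]_n} = q.
  by move=> tb; rewrite (size_basis (X := [tuple of map (@root_val R n D) t]) tb).
by rewrite -(e _ _ h) -(e _ _ h').
Qed.

Section Types.
Variables (R : realType) (n : nat) (D : rootSystem R n) (G : zmodType).
Variable (Rx : extRootSystem D G).
Variables (U : reflGroup (refl_system Rx)) (Z : zmodType) (w : invariantBihom Rx Z).
Variables (hw : is_universal_admissible w) (f : U -> ext_weyl_group hw).
Hypothesis fP : is_refl_morphism f.
Hypothesis free : is_free_abelian G.

(** The diagram is a tree in which each node but 0 has a neighbour of smaller index; along
    this tree all defects agree. *)
Lemma simply_laced_kernel (l : nat) (e : rel nat) : (2 <= l)%N ->
    (forall i, (0 < i < l)%N -> exists2 j, (j < i)%N & e j i) ->
    has_cartan_matrix D (cartan_simply_laced l e) ->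
  forall u, f u = 1%g -> u = 1%g.
Proof.
move=> l2 parent /cartan_base[s [base sC]].
have adjE (i j : 'I_l) : i != j -> e i j || e j i -> adjacent (tnth s i) (tnth s j).
  move=> ij eij; split; rewrite sC mxE ?(negPf ij) ?eij //.
  by rewrite eq_sym (negPf ij) orbC eij.
have l0 : (0 < l)%N by lia.
pose i0 : 'I_l := Ordinal l0.
have par (i : 'I_l) : i != i0 -> exists2 j : 'I_l, (j < i)%N & adjacent (tnth s j) (tnth s i).
  move=> ii0; have [|j ji eji] := parent i.
    by rewrite ltn_ord andbT lt0n; apply: contra ii0 => /eqP h; apply/eqP/val_inj.
  have jl : (j < l)%N by apply: ltn_trans ji _.
  exists (Ordinal jl) => //; apply: adjE; last by rewrite /= eji.
  by apply/eqP => /(congr1 val) /= h; rewrite h ltnn in ji.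
have nbr i : exists b, adjacent (tnth s i) b.
  have [->|/par[j _ adj]] := eqVneq i i0; last first.
    by exists (tnth s j); exact: adjacent_sym.
  pose i1 : 'I_l := Ordinal l2.
  have [|j j1 adj] := par i1; first by [].
  have jE : j = i0 by apply: val_inj; move: j1 => /=; lia.
  by exists (tnth s i1); rewrite -jE.
have link (i j : 'I_l) : linked (tnth s i) (tnth s j).
  have [ij|nij] := eqVneq i j; first by exists (tnth s i); split; left; rewrite // ij.
  have [eij|neij] := boolP (e i j || e j i).
    by exists (tnth s j); split; [right; exact: adjE|left].
  exists (tnth s i); split; [by left|right].
  by rewrite sC mxE (negPf nij) (negPf neij).
have chain (i : 'I_l) : slice Rx (tnth s i) = slice Rx (tnth s i0) /\
    forall g h, slice Rx (tnth s i) g -> slice Rx (tnth s i) h ->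
      simple_defect U s i g h = simple_defect U s i0 g h.
  have [m] := ubnP i; elim: m i => // m IH i im.
  have [->//|/par[j ji /adjacent_sym adj]] := eqVneq i i0.
  have [|Sj Cj] := IH j; first by move: im; lia.
  have Sij := slice_adjacent Rx adj; split; first by rewrite Sij.
  by move=> g h Sg Sh; rewrite (adjacent_simple_defect U adj) // Cj // -Sij.
move=> u; apply: (one_length_kernel fP base nbr link free (i0 := i0)) => [i|i g h Sg Sh].
  by have [] := chain i.
by have [_ Ci] := chain i; exact: Ci.
Qed.

Lemma two_length_type_kernel (l : nat) (s : l.-tuple (Defs.root D))
    (sh : pred 'I_l) (i0 i1 : 'I_l) (m : nat) :
    is_base s ->
    (forall i, exists b, adjacent (tnth s i) b) ->
    (forall i j, linked (tnth s i) (tnth s j)) ->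
    (forall i, let k := if sh i then i0 else i1 in i = k \/ adjacent (tnth s i) (tnth s k)) ->
    sh i0 -> ~~ sh i1 ->
    cartan (tnth s i0) (tnth s i1) = - m%:Z -> cartan (tnth s i1) (tnth s i0) = -1 ->
    (1 < m)%N -> k_factor D = m -> tame Rx ->
  forall u, f u = 1%g -> u = 1%g.
Proof.
move=> base nbr link same sh0 sh1 c01 c10 m1 km tameR.
have norm_lt : dot (root_val (tnth s i0)) (root_val (tnth s i0)) <
    dot (root_val (tnth s i1)) (root_val (tnth s i1)).
  have := cartan_sym (tnth s i0) (tnth s i1); rewrite c01 c10 !rmorphN /= !mulrN mulr1.
  move/oppr_inj <-; rewrite -[ltLHS]mulr1 ltr_pM2l ?norm_gt0 //.
  by rewrite -[1]/(1%:R) -pmulrn ltr_nat.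
case: tameR => [sl|[G1 [G2 twist]]].
  by move: norm_lt; rewrite (sl (tnth s i0) (tnth s i1)) ltxx.
have ns i : dot (root_val (tnth s i)) (root_val (tnth s i)) =
    dot (root_val (tnth s (if sh i then i0 else i1))) (root_val (tnth s (if sh i then i0 else i1))).
  by have /= [<-//|/adjacent_norm] := same i.
have ss i : slice Rx (tnth s i) = slice Rx (tnth s (if sh i then i0 else i1)).
  by have /= [<-//|/(slice_adjacent Rx)] := same i.
move=> u; apply: (@two_length_kernel _ _ _ _ _ _ _ _ _ _ fP _ _ base nbr link free sh i0 i1 m
  sh0 sh1 ns norm_lt ss _ c01 c10 G1 G2 twist km).
move=> i g h Sg Sh; have /= [<-//|adj] := same i.
exact: adjacent_simple_defect.
Qed.

(** The simple roots 0, 1 are short and 2, 3 long.  The pair (1, 2), not adjacent, is linked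
    by the simple root 0, which is adjacent to 1 and orthogonal to 2, and the pair (2, 1) is
    linked by the simple root 3. *)
Lemma F4_kernel : tame Rx -> has_cartan_matrix D cartan_F4 ->
  forall u, f u = 1%g -> u = 1%g.
Proof.
move=> tameR hF; have [s [base sC]] := cartan_base hF.
have km : k_factor D = 2%N.
  rewrite /k_factor; case: asboolP => // hG.
  by have := cartan_size hF hG.
pose c (i j : nat) : int :=
  if (i == 1)%N && (j == 2)%N then -2 else if i == j then 2
  else if (j == i.+1) || (i == j.+1) then -1 else 0.
have cE i j : cartan (tnth s i) (tnth s j) = c i j.
  by rewrite sC !mxE /c -val_eqE.
pose i0 : 'I_4 := @Ordinal 4 0 isT.
pose i1 : 'I_4 := @Ordinal 4 1 isT.
pose i2 : 'I_4 := @Ordinal 4 2 isT.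
pose i3 : 'I_4 := @Ordinal 4 3 isT.
have all4 (P : 'I_4 -> Prop) : P i0 -> P i1 -> P i2 -> P i3 -> forall i, P i.
  move=> P0 P1 P2 P3; case=> [[|[|[|[|//]]]] h];
    [move: P0|move: P1|move: P2|move: P3]; congr P; exact: val_inj.
have adj01 : adjacent (tnth s i0) (tnth s i1) by split; rewrite cE.
have adj23 : adjacent (tnth s i2) (tnth s i3) by split; rewrite cE.
apply: (@two_length_type_kernel _ s (fun i => i <= 1)%N i1 i2 2 base) => //; try by rewrite cE.
- by apply: (all4); [exists (tnth s i1)|exists (tnth s i0)|exists (tnth s i3)|exists (tnth s i2)].
- apply: (all4); apply: (all4);
    first [ by exists (tnth s i0); split; first [by left|by right; split; rewrite cE|by right; rewrite cE]
          | by exists (tnth s i1); split; first [by left|by right; split; rewrite cE|by right; rewrite cE]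
          | by exists (tnth s i2); split; first [by left|by right; split; rewrite cE|by right; rewrite cE]
          | by exists (tnth s i3); split; first [by left|by right; split; rewrite cE|by right; rewrite cE] ].
- by apply: (all4) => /=; [right|left|left|right].
Qed.

(** The simple root 0 is short and 1 is long. *)
Lemma G2_kernel : tame Rx -> has_cartan_matrix D cartan_G2 ->
  forall u, f u = 1%g -> u = 1%g.
Proof.
move=> tameR hG; have [s [base sC]] := cartan_base hG.
have km : k_factor D = 3%N by rewrite /k_factor asboolT.
pose i0 : 'I_2 := @Ordinal 2 0 isT.
pose i1 : 'I_2 := @Ordinal 2 1 isT.
have all2 (P : 'I_2 -> Prop) : P i0 -> P i1 -> forall i, P i.
  move=> P0 P1; case=> [[|[|//]] h]; [move: P0|move: P1]; congr P; exact: val_inj.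
have c01 : cartan (tnth s i0) (tnth s i1) = -3 by rewrite sC !mxE.
have c10 : cartan (tnth s i1) (tnth s i0) = -1 by rewrite sC !mxE.
have p01 : cartan (tnth s i0) (tnth s i1) * cartan (tnth s i1) (tnth s i0) = 3.
  by rewrite c01 c10.
have p10 : cartan (tnth s i1) (tnth s i0) * cartan (tnth s i0) (tnth s i1) = 3.
  by rewrite c01 c10.
apply: (@two_length_type_kernel _ s (fun i => i == i0) i0 i1 3 base) => //.
- by apply: (all2); eexists; [exact: g2_neighbour p01|exact: g2_neighbour p10].
- have link i j (pij : cartan (tnth s i) (tnth s j) * cartan (tnth s j) (tnth s i) = 3) :
      linked (tnth s i) (tnth s j).
    by have [adj orth] := g2_link pij; eexists; split; right; [exact: adj|exact: orth].
  apply: (all2); apply: (all2); try exact: (link).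
    by exists (tnth s i0); split; left.
  by exists (tnth s i1); split; left.
- by apply: (all2); left.
Qed.
End Types.

Theorem corollary7p26 (R : realType) (n : nat) (D : rootSystem R n)
    (G : zmodType) (hG : is_free_abelian G)
    (Rx : extRootSystem D G) (hR : tame Rx)
    (U : reflGroup (refl_system Rx)) (hU : is_initial U)
    (Z : zmodType) (w : invariantBihom Rx Z) (hw : is_universal_admissible w)
    (htype :
      (exists2 l : nat, (2 <= l)%N & has_cartan_matrix D (cartan_A l)) \/
      (exists2 l : nat, (4 <= l)%N & has_cartan_matrix D (cartan_D l)) \/
      (exists2 l : nat, (6 <= l <= 8)%N & has_cartan_matrix D (cartan_E l)) \/
      has_cartan_matrix D cartan_F4 \/
      has_cartan_matrix D cartan_G2) :
  exists f : U -> ext_weyl_group hw,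
    unique (fun g : U -> ext_weyl_group hw => is_refl_morphism g) f /\ bijective f.
Proof.
have [f [fP funiq]] := hU (ext_weyl_group hw).
exists f; split; first by split.
apply: refl_morphism_bijective => //.
case: htype => [[l l2]|[[l l4]|[[l l68]|[]]]].
- apply: (simply_laced_kernel fP hG) => // i /andP[i0 il].
  by exists i.-1; [lia|apply/eqP; lia].
- apply: (simply_laced_kernel fP hG) => [|i /andP[i0 il]]; first by lia.
  have [il1|il1] := eqVneq i l.-1.
    by exists (l - 3)%N; [lia|rewrite il1 !eqxx orbT].
  by exists i.-1; [lia|apply/orP; left; apply/andP; split; [apply/eqP|]; lia].
- apply: (simply_laced_kernel fP hG) => [|i /andP[i0 il]]; first by lia.
  have [il1|il1] := eqVneq i l.-1.
    by exists 2%N; [lia|rewrite il1 !eqxx orbT].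
  by exists i.-1; [lia|apply/orP; left; apply/andP; split; [apply/eqP|]; lia].
- exact: F4_kernel.
- exact: G2_kernel.
Qed.
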